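(* Let $0<\alpha<1$, $0\leq\beta\leq 1$ and $\gamma=\alpha+\beta(1-\alpha)$. Let $\psi\in C^{1}([a,b],\mathbb{R})$ be increasing with $\psi'(x)\neq 0$ for all $x\in[a,b]$. Let $f:[a,b]\times\mathbb{R}\to\mathbb{R}$ be a function such that $f(\cdot,y(\cdot))\in C_{1-\gamma;\psi}[a,b]$ for any $y\in C_{1-\gamma;\psi}[a,b]$, and such that for some constant $A>0$, $$|f(x,y_1)-f(x,y_2)|\leq A\,|y_1-y_2|\qquad\text{for all }x\in(a,b],\ y_1,y_2\in\mathbb{R}.$$ Let $y_a\in\mathbb{R}$ and let $\varepsilon>0$ be an arbitrary constant. Suppose that $y$ and $y^{*}$ are the solutions (in $C^{\alpha,\beta}_{1-\gamma;\psi}[a,b]$) of the initial value problems $${}^{H}\mathbb{D}_{a+}^{\alpha,\beta;\psi}y(x)=f(x,y(x)),\qquad I_{a+}^{1-\gamma;\psi}y(x)\big|_{x=a}=y_a,$$ and $${}^{H}\mathbb{D}_{a+}^{\alpha,\beta;\psi}y^{*}(x)=f(x,y^{*}(x)),\qquad I_{a+}^{1-\gamma;\psi}y^{*}(x)\big|_{x=a}=y_a+\varepsilon,$$ respectively. Then $$|y(x)-y^{*}(x)|\leq|\varepsilon|\left(\psi(x)-\psi(a)\right)^{\gamma-1}\mathbb{E}_{\alpha,\gamma}\!\left[A\left(\psi(x)-\psi(a)\right)^{\alpha}\right],\qquad x\in(a,b].$$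
   Context: Here $[a,b]$ with $0<a<b<\infty$ is a finite interval. For $\mu>0$, the fractional integral of $h$ with respect to $\psi$ is $$I_{a+}^{\mu;\psi}h(x)=\frac{1}{\Gamma(\mu)}\int_a^x\psi'(t)\left(\psi(x)-\psi(t)\right)^{\mu-1}h(t)\,dt,$$ and $I_{a+}^{0;\psi}$ is the identity. Values of such fractional integrals at $x=a$ are understood as limits as $x\to a^+$. For $0<\alpha<1$ and $0\le\beta\le1$, the (left-sided) $\psi$-Hilfer fractional derivative of order $\alpha$ and type $\beta$ is $${}^{H}\mathbb{D}_{a+}^{\alpha,\beta;\psi}h(x)=I_{a+}^{\beta(1-\alpha);\psi}\left(\frac{1}{\psi'(x)}\frac{d}{dx}\right)I_{a+}^{(1-\beta)(1-\alpha);\psi}h(x).$$ The weighted space $C_{1-\gamma;\psi}[a,b]$ is the set of functions $h:(a,b]\to\mathbb{R}$ such that $(\psi(t)-\psi(a))^{1-\gamma}h(t)\in C[a,b]$ (i.e. it extends to a continuous function on $[a,b]$), and $$C^{\alpha,\beta}_{1-\gamma;\psi}[a,b]=\left\{h\in C_{1-\gamma;\psi}[a,b]:\ {}^{H}\mathbb{D}_{a+}^{\alpha,\beta;\psi}h\in C_{1-\gamma;\psi}[a,b]\right\}.$$ The two-parameter Mittag-Leffler function is $\mathbb{E}_{\alpha,\gamma}(z)=\sum_{k=0}^{\infty}\dfrac{z^k}{\Gamma(\alpha k+\gamma)}$. *)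

(* Defs.v *)
From HB Require Import structures.
From mathcomp Require Import all_boot all_order all_algebra.
From mathcomp Require Import all_classical all_reals all_analysis.

Set Implicit Arguments.
Unset Strict Implicit.
Unset Printing Implicit Defensive.

Import Order.TTheory GRing.Theory Num.Theory.
Import numFieldNormedType.Exports.
Local Open Scope classical_set_scope.
Local Open Scope ring_scope.

Section special_functions.
Context {R : realType}.

Definition Gamma (s : R) : R :=
  \int[lebesgue_measure]_(t in `]0, +oo[) (t `^ (s - 1) * expR (- t)).

Definition mittag_leffler (alpha gamma z : R) : R :=
  limn [series z ^+ k / Gamma (alpha * k%:R + gamma)]_k.

End special_functions.

(* Derivatives of functions that only matter on a set D: difference quotients
   are taken inside D, so an endpoint of an interval gets the one-sided
   derivative.  As usual, [deriv_within] is meaningful only where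
   [derivable_within] holds. *)
Section derivative_within.
Context {R : realType}.
Implicit Types (D : set R) (F : R -> R) (x : R).

Definition diff_quotient F x (y : R) : R := (F y - F x) / (y - x).

Definition derivable_within D F x : Prop :=
  cvg (diff_quotient F x @ within D x^').

Definition deriv_within D F x : R :=
  lim (diff_quotient F x @ within D x^').

Definition C1_on (a b : R) F : Prop :=
  (forall x, x \in `[a, b] -> derivable_within `[a, b] F x) /\
  {within `[a, b], continuous (deriv_within `[a, b] F)}.

End derivative_within.

(* Functions on ]a, b] are represented by total functions R -> R of which only
   the values on ]a, b] are ever used. *)
Section psi_hilfer.
Context {R : realType}.
Variables (a b : R) (psi : R -> R).
Implicit Types (h : R -> R) (mu alpha beta gamma x : R).

Definition dpsi : R -> R := deriv_within `[a, b] psi.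

Definition frac_integrand mu h x (t : R) : R :=
  dpsi t * (psi x - psi t) `^ (mu - 1) * h t.

(* Meant for mu >= 0; the operator of order 0 is the identity. *)
Definition frac_int mu h x : R :=
  if mu == 0 then h x
  else (Gamma mu)^-1 *
       \int[lebesgue_measure]_(t in `]a, x[) frac_integrand mu h x t.

(* The Lebesgue integral is a total operator, so whether the integral defining
   [frac_int mu h x] makes sense has to be asked for separately. *)
Definition frac_int_exists mu h x : Prop :=
  mu != 0 ->
  lebesgue_measure.-integrable `]a, x[ (EFin \o frac_integrand mu h x).

Definition psi_deriv h x : R := (dpsi x)^-1 * deriv_within `]a, b] h x.

Definition hilfer alpha beta h : R -> R :=
  frac_int (beta * (1 - alpha))
    (psi_deriv (frac_int ((1 - beta) * (1 - alpha)) h)).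

(* All operations in the definition of [hilfer alpha beta h] make sense at
   every point of ]a, b]. *)
Definition hilfer_exists alpha beta h : Prop :=
  let F := frac_int ((1 - beta) * (1 - alpha)) h in
  forall x, x \in `]a, b] ->
    [/\ frac_int_exists ((1 - beta) * (1 - alpha)) h x,
        derivable_within `]a, b] F x
      & frac_int_exists (beta * (1 - alpha)) (psi_deriv F) x].

(* C_{1 - gamma; psi}[a, b], as a set indexed by gamma. *)
Definition weighted_C gamma : set (R -> R) :=
  [set h | exists g : R -> R, {within `[a, b], continuous g} /\
     forall t, t \in `]a, b] -> g t = (psi t - psi a) `^ (1 - gamma) * h t].

(* C^{alpha, beta}_{1 - gamma; psi}[a, b]. *)
Definition hilfer_C alpha beta gamma : set (R -> R) :=
  [set h | [/\ weighted_C gamma h, hilfer_exists alpha beta h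
             & weighted_C gamma (hilfer alpha beta h)]].

(* y is a solution in C^{alpha, beta}_{1 - gamma; psi}[a, b] of the initial
   value problem with right-hand side f and initial value c. *)
Definition hilfer_ivp alpha beta gamma (f : R -> R -> R) (c : R) (y : R -> R)
    : Prop :=
  [/\ hilfer_C alpha beta gamma y,
      forall x, x \in `]a, b] -> hilfer alpha beta y x = f x (y x)
    & frac_int (1 - gamma) y x @[x --> a^'+] --> c].

End psi_hilfer.

(* Main.v *)
Require Import Defs.
From HB Require Import structures.
From mathcomp Require Import all_boot all_order all_algebra.
From mathcomp Require Import all_classical all_reals all_analysis.
From mathcomp Require Import measurable_realfun ring lra.
Import Order.TTheory GRing.Theory Num.Theory.
Import numFieldNormedType.Exports.
Local Open Scope classical_set_scope.
Local Open Scope ring_scope.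

(* Write w = psi - psi(a) and p_k = w^(alpha k + gamma - 1) / Gamma(alpha k + gamma).
   Each solution satisfies the Volterra equation
     y = c p_0 + I^alpha f(., y),
   established here only after one integration, I^1 y = c I^1 p_0 + I^1 I^alpha f(., y):
   apply I^gamma to I^(1-gamma) y = c + I^1 G, with G the psi-derivative of
   I^(1-gamma) y, and use I^(gamma-alpha) G = f(., y) together with the semigroup law.
   All compositions then have total order at least 1, so the semigroup law holds at
   every point, not merely almost everywhere.  Since G is only known to be integrable,
   the equality of I^(1-gamma) y with c + I^1 G is the theorem that a function
   differentiable everywhere with an integrable derivative is the integral of its
   derivative.
   For u = y - ystar, a bound |u| <= Q thus gives |u| <= eps p_0 + A I^alpha Q, by
   comparing integrals over all subintervals of continuous functions.  As
   I^alpha p_k = p_(k+1) (Beta integral), iterating from |u| <= M p_0 yields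
     |u| <= eps sum_(k < n) A^k p_k + M A^n p_n,
   and the last term is a multiple of the general term of the Mittag-Leffler series. *)

(** * Change of variables, Gamma and Beta functions *)

(** The right-hand side of the integrated equation for u, called [v] in the final proof, is compared
    with u through integrals only. Integrability is therefore all that has to be shown about I^alpha
    f(., y); continuity on ]a, b] is asked of u and of its bound alone. The bounds Q are always
    finite combinations of the p_k, on which I^alpha is computed exactly by the Beta integral, so
    that neither a Gronwall inequality nor a fixed-point argument enters. The initial M is what the
    weighted space provides for the two solutions. The information on G comes from the meaning of
    the derivative: when gamma > alpha, the existence of the outer fractional integral at the single
    point b makes psi' G integrable on ]a, b[. Neither continuity nor boundedness of G is available,
    which rules out the fundamental theorem for C^1 functions. The Mittag-Leffler function is the
    limit of its partial sums, so convergence has to be proved; it follows from an elementary lower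
    bound on Gamma. *)

Section substitution.
Set Implicit Arguments.
Unset Strict Implicit.
Context {R : realType}.
Local Notation mu := (@lebesgue_measure R).
Implicit Types (F G f : R -> R) (s x t l m : R).

(** The integrands may blow up at the ends. The interval is exhausted by compact intervals, on which
    substitution for continuous integrands applies, and monotone convergence passes to the union on
    both sides. The identity thus holds in the extended reals, finite or not. *)
Lemma ge0_integration_by_substitution_oo F f G s x l m : s < x ->
  {in `]s, x[ &, {homo F : t u / t < u}} ->
  {in `]s, x[, forall t, is_derive t 1 F (f t)} ->
  {in `]s, x[, continuous f} -> {in `]s, x[, forall t, 0 <= f t} ->
  F t @[t --> s^'+] --> l -> F t @[t --> x^'-] --> m ->
  {in `]l, m[, continuous G} -> {in `]l, m[, forall t, 0 <= G t} ->
  (\int[mu]_(t in `]l, m[) (G t)%:E =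
   \int[mu]_(t in `]s, x[) (G (F t) * f t)%:E)%E.
Proof.
move=> sx incF dF cf f0 Fs Fx cG G0.
have cF : {in `]s, x[, continuous F}.
  move=> t tsx; apply/differentiable_continuous/derivable1_diffP.
  exact: (@ex_derive _ _ _ _ _ _ _ (dF t tsx)).
have F'E t : t \in `]s, x[ -> F^`()%classic t = f t.
  by move=> /dF ?; rewrite derive1E; exact: derive_val.
have cF' : {in `]s, x[, continuous F^`()%classic}.
  move=> t tsx; rewrite /continuous_at F'E//.
  apply: cvg_trans (cf _ tsx); apply: near_eq_cvg; near=> u.
  by apply/esym/F'E; near: u; exact: near_in_itvoo.
have Fl t : t \in `]s, x[ -> l < F t.
  move=> tsx; have stx : (s + t) / 2 \in `]s, x[.
    by move: tsx; rewrite !in_itv/= => /andP[? ?]; lra.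
  apply: (@le_lt_trans _ _ (F ((s + t) / 2))); last first.
    by apply: incF => //; move: tsx; rewrite in_itv/= => /andP[? ?]; lra.
  apply: (cvgr_to_le Fs); near=> u; apply/ltW/incF => //.
    by rewrite in_itv/=; apply/andP; split; near: u;
      [exact: nbhs_right_gt|exact: nbhs_right_lt].
  by near: u; apply: nbhs_right_lt; move: stx; rewrite in_itv/= => /andP[].
have Fm t : t \in `]s, x[ -> F t < m.
  move=> tsx; have stx : (t + x) / 2 \in `]s, x[.
    by move: tsx; rewrite !in_itv/= => /andP[? ?]; lra.
  apply: (@lt_le_trans _ _ (F ((t + x) / 2))).
    by apply: incF => //; move: tsx; rewrite in_itv/= => /andP[? ?]; lra.
  apply: (cvgr_to_ge Fx); near=> u; apply/ltW/incF => //.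
    by rewrite in_itv/=; apply/andP; split; near: u;
      [exact: nbhs_left_gt|exact: nbhs_left_lt].
  by near: u; apply: nbhs_left_gt; move: stx; rewrite in_itv/= => /andP[].
(* The denominator n + 3 keeps 2 d_n below the length x - s, so that [I n] is never degenerate. *)
pose d n : R := (x - s) / n.+3%:R.
have d0 n : 0 < d n by rewrite divr_gt0// subr_gt0.
have d3 n : d n *+ 2 < x - s.
  rewrite -mulr_natr -[ltRHS](@divfK _ n.+3%:R)// -/(d n).
  by rewrite ltr_pM2l// ltr_nat.
have ddec n k : (n <= k)%N -> d k <= d n.
  move=> nk; rewrite ler_pM2l ?subr_gt0// lef_pV2 ?posrE//.
  by rewrite ler_nat !ltnS.
have dcvg : d n @[n --> \oo] --> (0 : R).
  rewrite -[X in _ --> X](mulr0 (x - s)); apply: cvgMr.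
  by have := @cvg_harmonic R; rewrite -(cvg_shiftn 2); under eq_fun do rewrite addn2.
clearbody d.
pose I n := `[s + d n, x - d n]%classic.
pose J n := `[F (s + d n), F (x - d n)]%classic.
have sdn n : s + d n \in `]s, x[.
  by rewrite in_itv/=; move: (d0 n) (d3 n); rewrite mulr2n => *; lra.
have xdn n : x - d n \in `]s, x[.
  by rewrite in_itv/=; move: (d0 n) (d3 n); rewrite mulr2n => *; lra.
have sdx n : s + d n < x - d n.
  by move: (d0 n) (d3 n); rewrite mulr2n => *; lra.
have Isub n : I n `<=` `]s, x[.
  move=> t; rewrite /I/= !in_itv/= => /andP[h1 h2].
  by move: (d0 n) => ?; apply/andP; split; lra.
have Jsub n : J n `<=` `]l, m[.
  move=> t; rewrite /J/= !in_itv/= => /andP[h1 h2].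
  by rewrite (lt_le_trans (Fl _ (sdn n)) h1) (le_lt_trans h2 (Fm _ (xdn n))).
have UI : \bigcup_n I n = `]s, x[%classic.
  apply/seteqP; split => [t [n _ /Isub]//|t tsx].
  have : 0 < Num.min (t - s) (x - t).
    by move: tsx; rewrite /= in_itv/= lt_min; lra.
  move=> /(cvgr_lt _ dcvg)[n _ /(_ n (leqnn n))] /=.
  rewrite lt_min => /andP[h1 h2]; exists n => //; rewrite /I/=.
  by rewrite in_itv/=; lra.
have UJ : \bigcup_n J n = `]l, m[%classic.
  apply/seteqP; split => [t [n _ /Jsub]//|t] /=.
  rewrite in_itv/= => /andP[lt tm].
  have [n0 _ hn0] : \forall n \near \oo, F (s + d n) < t.
    apply: (@cvgr_lt _ _ _ _ (fun n => F (s + d n)) l) => //.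
    move/cvg_at_rightP : Fs; apply; split=> [n|]; first by rewrite ltrDl.
    by rewrite -[X in _ --> X]addr0; apply: cvgD => //; exact: cvg_cst.
  have [n1 _ hn1] : \forall n \near \oo, t < F (x - d n).
    apply: (@cvgr_gt _ _ _ _ (fun n => F (x - d n)) m) => //.
    move/cvg_at_leftP : Fx; apply; split=> [n|]; first by rewrite gtrBl.
    by rewrite -[X in _ --> X]subr0; apply: cvgB => //; exact: cvg_cst.
  exists (maxn n0 n1) => //; rewrite /J/= in_itv/= !ltW//.
    by apply: hn1; rewrite /= leq_maxr.
  by apply: hn0; rewrite /= leq_maxl.
have Fle t u : t \in `]s, x[ -> u \in `]s, x[ -> t <= u -> F t <= F u.
  move=> ts us; rewrite le_eqVlt => /predU1P[->//|tu].
  by apply/ltW/incF.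
have mG : measurable_fun `]l, m[ G.
  apply: open_continuous_measurable_fun; first exact: interval_open.
  by move=> t; rewrite inE/=; exact: cG.
have mGF : measurable_fun `]s, x[ (fun t => G (F t) * f t).
  apply: open_continuous_measurable_fun; first exact: interval_open.
  move=> t; rewrite inE/= => tsx.
  apply: cvgM; last exact: cf.
  apply: continuous_comp; first exact: cF.
  by apply: cG; rewrite in_itv/= Fl//= Fm.
have ndI : nondecreasing_seq I.
  move=> n k nk; rewrite subsetEset => t; rewrite /I /= !in_itv/= => /andP[h1 h2].
  by move: (ddec _ _ nk) => ?; apply/andP; split; lra.
have ndJ : nondecreasing_seq J.
  move=> n k nk; rewrite subsetEset => t; rewrite /J /= !in_itv/= => /andP[h1 h2].
  rewrite (le_trans _ h1) ?(le_trans h2)//; apply: Fle => //;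
  by move: (ddec _ _ nk) => *; lra.
rewrite -UI -UJ.
(* The integrals over [J n] and over [I n] form one and the same sequence; the two sides of the goal
   are its limits. *)
apply: (@cvg_unique _ (@ereal_hausdorff R) (\int[mu]_(t in J n) (G t)%:E @[n --> \oo])%E) => //.
  apply: ge0_nondecreasing_set_cvg_integral => //.
  - by move=> n; exact: measurable_itv.
  - by move=> n; apply/measurable_EFinP; exact: measurable_funS (@Jsub n) mG.
  - by move=> n t /Jsub /G0; rewrite lee_fin.
have -> : (fun n => \int[mu]_(t in J n) (G t)%:E)%E =
    (fun n => \int[mu]_(t in I n) (G (F t) * f t)%:E)%E.
  apply/funext => n.
  have subcc t : t \in `[s + d n, x - d n] -> t \in `]s, x[ by exact: Isub.
  have suboo t : t \in `]s + d n, x - d n[ -> t \in `]s, x[.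
    by move=> /subset_itv_oo_cc; exact: Isub.
  rewrite (@integration_by_substitution_increasing R F G (s + d n) (x - d n)).
  - apply: eq_integral => t; rewrite inE/= => tI.
    by rewrite !fctE F'E//; exact: subcc.
  - exact: ltW.
  - by move=> t u /subcc ts /subcc us; exact: incF.
  - by move=> t /suboo; exact: cF'.
  - apply/cvg_ex; exists (F^`()%classic (s + d n)).
    by apply: cvg_at_right_filter; exact: cF'.
  - apply/cvg_ex; exists (F^`()%classic (x - d n)).
    by apply: cvg_at_left_filter; exact: cF'.
  - split=> [t /suboo /dF ?||]; first exact: ex_derive.
      by apply: cvg_at_right_filter; exact: cF.
    by apply: cvg_at_left_filter; exact: cF.
  - apply: continuous_in_subspaceT => t; rewrite inE => /Jsub.
    exact: cG.
apply: ge0_nondecreasing_set_cvg_integral => //.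
- by move=> n; exact: measurable_itv.
- by move=> n; apply/measurable_EFinP; exact: measurable_funS (@Isub n) mGF.
- move=> n t /Isub tsx; rewrite lee_fin mulr_ge0//; last exact: f0.
  by apply: G0; rewrite in_itv/= Fl//= Fm.
Unshelve. all: end_near. Qed.
End substitution.

Section translation.
Set Implicit Arguments.
Unset Strict Implicit.
Context {R : realType}.
Local Notation mu := (@lebesgue_measure R).

(** By uniqueness of the Lebesgue measure it is enough to compare the two measures on half-open
    intervals. *)
Lemma lebesgue_measure_translation (t : R) (A : set R) : measurable A ->
  pushforward mu (fun u : measurableTypeR R => u - t : measurableTypeR R) A = mu A.
Proof.
have mf : measurable_fun setT (fun u : measurableTypeR R => u - t : measurableTypeR R).
  by apply: measurable_funB.
pose ff := isMeasurableFun.Build _ _ _ _ _ mf.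
pose f : {mfun measurableTypeR R >-> measurableTypeR R} := HB.pack (fun u => u - t) ff.
move=> mA; apply/esym.
apply: (@lebesgue_measure_unique _ (pushforward mu f)) => //= _ [[a b]] _ <-.
rewrite /pushforward/=.
rewrite (_ : _ @^-1` _ = `]a + t, b + t]%classic); last first.
  by apply/seteqP; split=> x /=; rewrite !in_itv/= ltrBrDr lerBlDr.
rewrite !lebesgue_measure_itv/= !lte_fin ltrD2r.
by case: ifP => // _; rewrite -!EFinB; congr EFin; ring.
Qed.

Lemma ge0_integral_translation (g : R -> R) (t : R) : measurable_fun setT g ->
  (forall u, 0 <= g u) ->
  (\int[mu]_u (g (u - t))%:E = \int[mu]_u (g u)%:E)%E.
Proof.
move=> mg g0.
have mf : measurable_fun setT (fun u : measurableTypeR R => u - t : measurableTypeR R).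
  by apply: measurable_funB.
have := @ge0_integral_pushforward _ _ _ _ R _ mf mu setT (EFin \o g) measurableT.
rewrite preimage_setT => <-//=.
- by apply: eq_measure_integral => A mA _; exact: lebesgue_measure_translation.
- exact/measurable_EFinP.
- by move=> *; rewrite lee_fin.
Qed.

End translation.

(** * The Gamma function: finiteness, positivity and growth *)

Section gamma.
Set Implicit Arguments.
Unset Strict Implicit.
Context {R : realType}.
Local Notation mu := (@lebesgue_measure R).
Implicit Types (s p q t u x L : R).

Let gexp s t : R := t `^ (s - 1) * expR (- t).

Let gexp_ge0 s t : 0 <= gexp s t.
Proof. by rewrite mulr_ge0 ?powR_ge0 ?expR_ge0. Qed.

Let measurable_gexp s : measurable_fun setT (gexp s).
Proof.
apply: measurable_funM; first exact: measurable_powR.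
by apply: measurableT_comp => //; exact: measurable_expR.
Qed.

Let measurable_EFin_gexp D s : measurable_fun D (fun t => (gexp s t)%:E).
Proof.
by apply: measurable_funTS; apply/measurable_EFinP; exact: measurable_gexp.
Qed.

(** The substitution u = t^s maps ]0, 1[ onto itself and carries the constant 1 to this integrand,
    which takes care of the singular end 0. *)
Lemma integral_powR01 s : 0 < s ->
  (\int[mu]_(t in `]0%R, 1%R[) (s * t `^ (s - 1))%:E = 1)%E.
Proof.
move=> s0.
have -> : (1 = \int[mu]_(t in `]0%R, 1%R[) (cst 1 t)%:E :> \bar R)%E.
  by rewrite /= integral_cst//= lebesgue_measure_itv/= lte_fin ltr01 sube0 mule1.
apply/esym; rewrite (@ge0_integration_by_substitution_oo _ (fun t => t `^ s)
   (fun t => s * t `^ (s - 1)) (cst 1) 0 1 0 1) //.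
- by apply: eq_integral => t _; rewrite /= mul1r.
- move=> t u; rewrite !in_itv/= => /andP[t0 _] /andP[u0 _].
  by apply: gt0_ltr_powR => //; rewrite nnegrE ltW.
- by move=> t; rewrite in_itv/= => /andP[t0 _]; exact: is_derive1_powR.
- move=> t; rewrite in_itv/= => /andP[t0 _].
  apply: cvgMr; suff : {for t, continuous (fun u => u `^ (s - 1))} by [].
  apply: differentiable_continuous.
  by apply/derivable1_diffP; apply: derivable_powR; rewrite in_itv/= t0.
- by move=> t _; rewrite mulr_ge0 ?powR_ge0 ?ltW.
- exact: powR_cvg0.
- apply: cvg_at_left_filter.
  have : differentiable (fun t : R => t `^ s) (1 : R).
    by apply/derivable1_diffP; apply: derivable_powR; rewrite in_itv/= ltr01.
  have e1 : (1 : R) `^ s = 1 by rewrite powR1.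
  by move=> /differentiable_continuous; rewrite -[X in _ -> _ --> X]e1.
- by move=> t _; exact: cvg_cst.
Qed.

(** Write t^s = (2 s)^s (t / (2 s))^s and bound t / (2 s) by its exponential. *)
Lemma powR_le_expR s t : 0 < s -> 0 <= t -> t `^ s <= (2 * s) `^ s * expR (t / 2).
Proof.
move=> s0 t0.
have -> : t / 2 = t / (2 * s) * s by field; rewrite gt_eqF.
rewrite expRM -powRM ?expR_ge0//; last by rewrite mulr_ge0// ltW.
have s2 : 0 < 2 * s by rewrite mulr_gt0.
apply: ge0_ler_powR; rewrite ?nnegrE ?mulr_ge0 ?expR_ge0 ?(ltW s0) ?(ltW s2)//.
rewrite -ler_pdivrMl// mulrC (le_trans _ (expR_ge1Dx _))//.
by rewrite lerDr.
Qed.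

(** Below 1 the integrand is dominated by t^(s - 1); above 1, through [powR_le_expR], by a multiple
    of the exponential density of rate 1/2. The factor 2 in [h2] cancels that rate. *)
Lemma Gamma_lty s : 0 < s ->
  (\int[mu]_(t in `]0%R, +oo[) (gexp s t)%:E < +oo)%E.
Proof.
move=> s0.
pose h1 t : \bar R := (t `^ (s - 1))%:E.
pose h2 t : \bar R := (((2 * s) `^ s * 2) * exponential_pdf 2^-1 t)%:E.
have m1 D : measurable_fun D h1.
  by apply: measurable_funTS; apply/measurable_EFinP; exact: measurable_powR.
have m2 D : measurable_fun D h2.
  apply: measurable_funTS; apply/measurable_EFinP.
  by apply: measurable_funM => //; exact: measurable_exponential_pdf.
have h20 t : (0 <= h2 t)%E.
  by rewrite lee_fin !mulr_ge0 ?powR_ge0 ?exponential_pdf_ge0.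
have -> : `]0%R, +oo[%classic = `]0%R, 1%R[ `|` `[1%R, +oo[ :> set R.
  rewrite -itv_bndbnd_setU// ?bnd_simp//.
rewrite ge0_integral_setU//=; last first.
- apply/disj_setPS => t /= []; rewrite !in_itv/= => /andP[_ t1] /andP[t1' _].
  by move: t1; rewrite ltNge t1'.
- by move=> t _; rewrite lee_fin.
- exact: measurable_EFin_gexp.
apply: lte_add_pinfty.
  apply: (@le_lt_trans _ _ (\int[mu]_(t in `]0%R, 1%R[) h1 t)%E).
    apply: ge0_le_integral => //=.
    - by move=> t _; rewrite lee_fin.
    - exact: measurable_EFin_gexp.
    - exact: m1.
    - by move=> t; rewrite in_itv/= => /andP[t0 _]; rewrite lee_fin ler_piMr ?powR_ge0//
        -expR0 ler_expR oppr_le0 ltW.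
  have := integral_powR01 s0; under eq_integral do rewrite EFinM.
  rewrite ge0_integralZl//=; last 3 first.
  - exact: m1.
  - by move=> t _; rewrite lee_fin powR_ge0.
  - by rewrite lee_fin ltW.
  rewrite -/h1; case: (integral _ _ _) => [r _| |]//.
  - by rewrite ltry.
  - by rewrite mulry gtr0_sg// mul1e.
apply: (@le_lt_trans _ _ (\int[mu]_t h2 t)%E).
  apply: (@le_trans _ _ (\int[mu]_(t in `[1%R, +oo[) h2 t)%E).
    apply: ge0_le_integral => //=.
    - by move=> t _; rewrite lee_fin.
    - exact: measurable_EFin_gexp.
    - exact: m2.
    - move=> t; rewrite in_itv/= andbT => t1; rewrite lee_fin.
      have t0 : 0 <= t by exact: le_trans t1.
      rewrite exponential_pdfE// mulrA (_ : _ * 2 * 2^-1 = (2 * s) `^ s); last by field.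
      rewrite /gexp (_ : - t = - 2^-1 * t - t / 2); last by field.
      rewrite expRD mulrCA mulrC ler_wpM2r ?expR_ge0//.
      rewrite expRN ler_pdivrMr ?expR_gt0//.
      apply: le_trans (powR_le_expR s0 t0).
      by rewrite ler_powR// gerBl.
  by apply: ge0_subset_integral => //=; exact: m2.
rewrite /h2; under eq_integral do rewrite EFinM.
rewrite ge0_integralZl//=; last 3 first.
- by apply/measurable_EFinP; exact: measurable_exponential_pdf.
- by move=> t _; rewrite lee_fin exponential_pdf_ge0.
- by rewrite lee_fin mulr_ge0 ?powR_ge0.
by rewrite integral_exponential_pdf// mule1 ltry.
Qed.

Lemma EFin_Gamma s : 0 < s ->
  (Gamma s)%:E = (\int[mu]_(t in `]0%R, +oo[) (t `^ (s - 1) * expR (- t))%:E)%E.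
Proof.
move=> s0; rewrite /Gamma /Rintegral fineK// ge0_fin_numE; first exact: Gamma_lty.
by apply: integral_ge0 => t _; rewrite lee_fin; exact: gexp_ge0.
Qed.

(** On [L, 2 L], an interval of length L, the integrand is at least L^s e^(-2 L) / (2 L). As L is
    free, [Gamma] outgrows every geometric sequence along an arithmetic progression. *)
Lemma Gamma_lower_bound s L : 0 < s -> 0 < L -> L `^ s * expR (- (2 * L)) / 2 <= Gamma s.
Proof.
move=> s0 L0; rewrite -lee_fin EFin_Gamma//.
apply: (@le_trans _ _ (\int[mu]_(t in `[L, (2 * L)%R]) (L `^ s * expR (- (2 * L)) / (2 * L))%:E)%E).
  rewrite integral_cst//= lebesgue_measure_itv/= lte_fin ltr_pMl// ltr1n -EFinB -EFinM lee_fin.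
  by rewrite le_eqVlt; apply/orP; left; apply/eqP; field; rewrite gt_eqF.
apply: (@le_trans _ _ (\int[mu]_(t in `[L, (2 * L)%R]) (gexp s t)%:E)%E).
  apply: ge0_le_integral => //=.
  - by move=> t _; rewrite lee_fin divr_ge0 ?mulr_ge0 ?powR_ge0 ?expR_ge0// ltW.
  - exact: measurable_EFin_gexp.
  - move=> t; rewrite in_itv/= => /andP[Lt t2]; rewrite lee_fin /gexp mulrAC.
    have t0 : 0 < t by exact: lt_le_trans Lt.
    rewrite ler_pM ?divr_ge0 ?powR_ge0 ?expR_ge0 ?mulr_ge0 ?(ltW L0)//; last first.
      by rewrite ler_expR lerN2.
    have -> : t `^ (s - 1) = t `^ s / t.
      by rewrite powRB ?(gt_eqF t0) ?implybT// powRr1// ltW.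
    rewrite ler_pM ?powR_ge0 ?invr_ge0 ?mulr_ge0 ?(ltW L0)//.
      by rewrite ge0_ler_powR ?nnegrE// ltW.
    by rewrite lef_pV2 ?posrE// mulr_gt0.
apply: ge0_subset_integral => //=.
- exact: measurable_EFin_gexp.
- by move=> t _; rewrite lee_fin; exact: gexp_ge0.
- by move=> t /=; rewrite !in_itv/= andbT => /andP[Lt _]; exact: lt_le_trans Lt.
Qed.

Lemma Gamma_gt0 s : 0 < s -> 0 < Gamma s.
Proof.
move=> s0; apply: lt_le_trans (Gamma_lower_bound s0 ltr01).
by rewrite divr_gt0// mulr_gt0 ?powR_gt0 ?expR_gt0.
Qed.

Lemma Gamma_neq0 s : 0 < s -> Gamma s != 0.
Proof. by move=> s0; rewrite gt_eqF// Gamma_gt0. Qed.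

Lemma Gamma1 : Gamma (1 : R) = 1.
Proof.
apply: EFin_inj; rewrite EFin_Gamma//.
rewrite -(@integral_exponential_pdf R 1 ltr01).
rewrite [LHS]integral_itv_obnd_cbnd; last first.
  exact: measurable_EFin_gexp.
rewrite [LHS]integral_mkcond; apply: eq_integral => t _.
rewrite /exponential_pdf !patchE; case: ifPn => // t0.
by rewrite subrr powRr0 mulN1r.
Qed.

End gamma.

(** * The Beta integral and power kernels *)

Section beta.
Set Implicit Arguments.
Unset Strict Implicit.
Context {R : realType}.
Local Notation mu := (@lebesgue_measure R).
Implicit Types (s p q t u x : R) (F f : R -> R).

(** Valued in the extended reals, so that identities can be proved for it before its finiteness is
    known. *)
Definition beta_integral p q : \bar R :=
  (\int[mu]_(t in `]0%R, 1%R[) ((1 - t) `^ (p - 1) * t `^ (q - 1))%:E)%E.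

Lemma continuous_powR s t : 0 < t -> {for t, continuous (fun u => u `^ s)}.
Proof.
move=> t0; apply: differentiable_continuous; apply/derivable1_diffP.
by apply: derivable_powR; rewrite in_itv/= t0.
Qed.

(** The affine normalisation (F t - F s) / (F x - F s) sends the interval onto ]0, 1[. [F] is kept
    general because the identity yields the convolution of powers, and psi the kernel of the
    fractional integrals. *)
Lemma power_kernel_beta F f s x p q : s < x -> F s < F x ->
  {in `]s, x[ &, {homo F : t u / t < u}} ->
  {in `]s, x[, forall t, is_derive t 1 F (f t)} ->
  {in `]s, x[, continuous f} -> {in `]s, x[, forall t, 0 <= f t} ->
  F t @[t --> s^'+] --> F s -> F t @[t --> x^'-] --> F x ->
  (\int[mu]_(t in `]s, x[)
     ((F x - F t) `^ (p - 1) * (F t - F s) `^ (q - 1) * f t)%:E =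
   ((F x - F s) `^ (p + q - 1))%:E * beta_integral p q)%E.
Proof.
move=> sx Fsx incF dF cf f0 Fs Fx.
pose D := F x - F s.
have D0 : 0 < D by rewrite subr_gt0.
have Fst t : t \in `]s, x[ -> F s < F t.
  move=> tsx; have tsx2 : (s + t) / 2 \in `]s, x[.
    by move: tsx; rewrite !in_itv/= => /andP[? ?]; apply/andP; split; lra.
  apply: (@le_lt_trans _ _ (F ((s + t) / 2))); last first.
    by apply: incF => //; move: tsx; rewrite in_itv/= => /andP[? ?]; lra.
  apply: (cvgr_to_le Fs); near=> u; apply/ltW/incF => //.
    by rewrite in_itv/=; apply/andP; split; near: u;
      [exact: nbhs_right_gt|exact: nbhs_right_lt].
  by near: u; apply: nbhs_right_lt; move: tsx2; rewrite in_itv/= => /andP[].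
have Ftx t : t \in `]s, x[ -> F t < F x.
  move=> tsx; have tsx2 : (t + x) / 2 \in `]s, x[.
    by move: tsx; rewrite !in_itv/= => /andP[? ?]; apply/andP; split; lra.
  apply: (@lt_le_trans _ _ (F ((t + x) / 2))).
    by apply: incF => //; move: tsx; rewrite in_itv/= => /andP[? ?]; lra.
  apply: (cvgr_to_ge Fx); near=> u; apply/ltW/incF => //.
    by rewrite in_itv/=; apply/andP; split; near: u;
      [exact: nbhs_left_gt|exact: nbhs_left_lt].
  by near: u; apply: nbhs_left_gt; move: tsx2; rewrite in_itv/= => /andP[].
have cF : {in `]s, x[, continuous F}.
  move=> t tsx; apply/differentiable_continuous/derivable1_diffP.
  exact: (@ex_derive _ _ _ _ _ _ _ (dF t tsx)).
have mK : measurable_fun `]s, x[ (fun t => (F x - F t) `^ (p - 1) * (F t - F s) `^ (q - 1) * f t).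
  apply: open_continuous_measurable_fun; first exact: interval_open.
  move=> t; rewrite inE/= => tsx.
  apply: cvgM; last exact: cf.
  have cFt := cF _ tsx.
  apply: cvgM.
    apply: (continuous_comp (f := fun t => F x - F t) (g := fun u => u `^ (p - 1))).
      by apply: cvgB => //; exact: cvg_cst.
    by apply: continuous_powR; rewrite subr_gt0 Ftx.
  apply: (continuous_comp (f := fun t => F t - F s) (g := fun u => u `^ (q - 1))).
    by apply: cvgB => //; exact: cvg_cst.
  by apply: continuous_powR; rewrite subr_gt0 Fst.
rewrite /beta_integral (@ge0_integration_by_substitution_oo R (fun t => D^-1 * (F t - F s)) (fun t => D^-1 * f t)
  (fun t => (1 - t) `^ (p - 1) * t `^ (q - 1)) s x 0 1) //; last 8 first.
- by move=> t u ts us tu; rewrite ltr_pM2l ?invr_gt0// ltrD2r incF.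
- move=> t tsx; have Ft := dF t tsx.
  by apply: is_derive_eq; rewrite subr0.
- move=> t tsx; apply: cvgMr; exact: cf.
- by move=> t tsx; rewrite mulr_ge0 ?invr_ge0 ?(ltW D0)// f0.
- rewrite -(mulr0 D^-1) -(subrr (F s)); apply: cvgMr.
  by apply: cvgB => //; exact: cvg_cst.
- rewrite -(mulVf (lt0r_neq0 D0)); apply: cvgMr.
  by apply: cvgB => //; exact: cvg_cst.
- move=> t; rewrite in_itv/= => /andP[t0 t1]; apply: cvgM.
    apply: (continuous_comp (f := fun t => 1 - t) (g := fun u => u `^ (p - 1))).
      by apply: cvgB; [exact: cvg_cst|exact: cvg_id].
    by apply: continuous_powR; rewrite subr_gt0.
  exact: continuous_powR.
- by move=> t _; rewrite mulr_ge0 ?powR_ge0.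
(* The powers of 1 / D collected here are p - 1 and q - 1 from the two factors and 1 from the
   derivative. *)
have E t : t \in `]s, x[ -> (1 - D^-1 * (F t - F s)) `^ (p - 1) * (D^-1 * (F t - F s)) `^ (q - 1) *
    (D^-1 * f t) = (D `^ (p + q - 1))^-1 * ((F x - F t) `^ (p - 1) * (F t - F s) `^ (q - 1) * f t).
  move=> tsx.
  have -> : 1 - D^-1 * (F t - F s) = D^-1 * (F x - F t).
    by rewrite /D; field; rewrite lt0r_neq0.
  have h1 : 0 <= D^-1 by rewrite invr_ge0 ltW.
  have h2 : 0 <= F x - F t by rewrite subr_ge0 ltW// Ftx.
  have h3 : 0 <= F t - F s by rewrite subr_ge0 ltW// Fst.
  rewrite !powRM//.
  have -> : (D `^ (p + q - 1))^-1 = D^-1 `^ (p - 1) * D^-1 `^ (q - 1) * D^-1.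
    rewrite -[X in _ * X](powRr1)// ?invr_ge0 ?(ltW D0)//.
    rewrite -!powRD ?invr_eq0 ?(gt_eqF D0) ?implybT//.
    rewrite -powRN -powR_inv1 ?(ltW D0)// -powRrM; congr (_ `^ _); ring.
  ring.
under [in RHS]eq_integral.
  move=> t; rewrite inE/= => /E ->; rewrite EFinM; over.
rewrite ge0_integralZl//=; last 3 first.
- exact/measurable_EFinP.
- move=> t tsx; rewrite lee_fin !mulr_ge0 ?powR_ge0//; exact: f0.
- by rewrite lee_fin invr_ge0 powR_ge0.
rewrite muleA -EFinM divff ?mul1e//.
by rewrite gt_eqF// powR_gt0.
Unshelve. all: end_near. Qed.

End beta.

Section beta_gamma.
Set Implicit Arguments.
Unset Strict Implicit.
Context {R : realType}.
Local Notation mu := (@lebesgue_measure R).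
Implicit Types (s p q t u x : R) (F f : R -> R).

(** Cut off at 0, so that Gamma integrals and convolutions become integrals over the whole line,
    ready for translation and Tonelli. *)
Let phi p t : R := if 0 < t then t `^ (p - 1) else 0.

Let phi_ge0 p t : 0 <= phi p t.
Proof. by rewrite /phi; case: ifP => // _; exact: powR_ge0. Qed.

Let measurable_phi p : measurable_fun setT (phi p).
Proof.
apply: measurable_fun_ifT.
- by apply: measurable_fun_ltr.
- exact: measurable_powR.
- exact: measurable_cst.
Qed.

Let measurable_phiB p u : measurable_fun setT (fun t => phi p (u - t)).
Proof.
by apply: measurableT_comp; [exact: measurable_phi|exact: measurable_funB].
Qed.

Let measurable_expRN : measurable_fun setT (fun t : R => expR (- t)).
Proof. by apply: measurableT_comp => //; exact: measurable_expR. Qed.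

Let measurable_phi_expR p : measurable_fun setT (fun t => phi p t * expR (- t)).
Proof. by apply: measurable_funM; [exact: measurable_phi|]. Qed.

Let Gamma_phi p : 0 < p ->
  (\int[mu]_t (phi p t * expR (- t))%:E = (Gamma p)%:E)%E.
Proof.
move=> p0; rewrite EFin_Gamma// [RHS]integral_mkcond; apply: eq_integral => t _.
rewrite /phi patchE mem_setE in_itv/= andbT.
by case: ifP => // _; rewrite mul0r.
Qed.

Let convolution p q u :
  (\int[mu]_t (phi p (u - t) * phi q t)%:E =
   (phi (p + q) u)%:E * beta_integral p q)%E.
Proof.
have [u0|u0] := ltP 0 u; last first.
  rewrite integral0_eq => [|t _]; first by rewrite /phi ltNge u0 mul0e.
  rewrite /phi; case: ltP => [h|]; case: ltP => [h'|]; rewrite ?mul0r ?mulr0//.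
  by move: h; rewrite subr_gt0 => /(lt_trans h'); rewrite ltNge u0.
rewrite {3}/phi u0; have := @power_kernel_beta R id (cst 1) 0 u p q u0 u0.
rewrite subr0 => <-.
- rewrite [RHS]integral_mkcond; apply: eq_integral => t _.
  rewrite /phi patchE mem_setE in_itv/= mulr1 subr_gt0 subr0.
  by case: ifP; case: ifP; rewrite ?mul0r ?mulr0.
- by [].
- by move=> t _; exact: is_derive_id.
- by move=> t _; exact: cvg_cst.
- by move=> t _; exact: ler01.
- by apply: cvg_at_right_filter; exact: cvg_id.
- by apply: cvg_at_left_filter; exact: cvg_id.
Qed.

(** The double integral of [phi p (u - t) * phi q t * expR (- u)] is computed in both orders.
    Integrating in t first gives the convolution, hence B(p, q) Gamma(p + q); integrating in u first
    gives Gamma(p) Gamma(q) after a translation. *)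
Lemma beta_integral_Gamma p q : 0 < p -> 0 < q ->
  beta_integral p q = (Gamma p * Gamma q / Gamma (p + q))%:E.
Proof.
move=> p0 q0; have pq0 : 0 < p + q by rewrite addr_gt0.
pose h (z : R * R) : \bar R := (phi p (z.1 - z.2) * phi q z.2 * expR (- z.1))%:E.
have mh : measurable_fun setT h.
  apply/measurable_EFinP/measurable_funM.
    apply: measurable_funM; last by apply: measurableT_comp; [exact: measurable_phi|].
    by apply: measurableT_comp; [exact: measurable_phi|exact: measurable_funB].
  by apply: (measurableT_comp measurable_expRN).
have h0 z : (0 <= h z)%E by rewrite lee_fin !mulr_ge0 ?expR_ge0.
have := @fubini_tonelli _ _ _ _ R mu mu h mh h0.
have -> : (\int[mu]_x \int[mu]_y h (x, y) = beta_integral p q * (Gamma (p + q))%:E)%E.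
  under eq_integral => u _.
    rewrite /h/=; under eq_integral do rewrite EFinM.
    rewrite ge0_integralZr//=; last 2 first.
    - apply/measurable_EFinP/measurable_funM; first exact: measurable_phiB.
      exact: measurable_phi.
    - by move=> t _; rewrite lee_fin mulr_ge0.
    rewrite convolution muleAC -EFinM muleC; over.
  rewrite ge0_integralZl//=.
  - by rewrite Gamma_phi.
  - by apply/measurable_EFinP; exact: measurable_phi_expR.
  - by move=> t _; rewrite lee_fin mulr_ge0 ?expR_ge0.
  - by apply: integral_ge0 => t _; rewrite lee_fin mulr_ge0 ?powR_ge0.
have -> : (\int[mu]_y \int[mu]_x h (x, y) = (Gamma p * Gamma q)%:E)%E.
  under eq_integral => t _.
    rewrite /h/=; under eq_integral => u _.
      rewrite (_ : phi p (u - t) * _ * _ = phi q t * expR (- t) * (phi p (u - t) * expR (- (u - t)))); last first.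
        by rewrite opprB expRD !expRN; field; rewrite !gt_eqF ?expR_gt0.
      rewrite EFinM; over.
    rewrite ge0_integralZl//=; last 3 first.
    - apply/measurable_EFinP.
      apply: (measurableT_comp (measurable_phi_expR p)).
      exact: measurable_funB.
    - by move=> u _; rewrite lee_fin mulr_ge0 ?expR_ge0.
    - by rewrite lee_fin mulr_ge0 ?expR_ge0.
    rewrite (ge0_integral_translation (g := fun u => phi p u * expR (- u))); last 2 first.
    - exact: measurable_phi_expR.
    - by move=> u; rewrite mulr_ge0 ?expR_ge0.
    rewrite Gamma_phi//; over.
  rewrite ge0_integralZr//=.
  - by rewrite (Gamma_phi q0) -EFinM (mulrC (Gamma q)).
  - by apply/measurable_EFinP; exact: measurable_phi_expR.
  - by move=> t _; rewrite lee_fin mulr_ge0 ?expR_ge0.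
  - by rewrite lee_fin ltW// Gamma_gt0.
move/(congr1 (fun e => e * ((Gamma (p + q))^-1)%:E)%E).
have G0 := Gamma_gt0 pq0.
by rewrite -muleA -!EFinM divff ?gt_eqF// mule1 => ->.
Qed.

Lemma power_kernel_integral F f s x p q : 0 < p -> 0 < q -> s < x -> F s < F x ->
  {in `]s, x[ &, {homo F : t u / t < u}} ->
  {in `]s, x[, forall t, is_derive t 1 F (f t)} ->
  {in `]s, x[, continuous f} -> {in `]s, x[, forall t, 0 <= f t} ->
  F t @[t --> s^'+] --> F s -> F t @[t --> x^'-] --> F x ->
  (\int[mu]_(t in `]s, x[)
     ((F x - F t) `^ (p - 1) * (F t - F s) `^ (q - 1) * f t)%:E =
   ((F x - F s) `^ (p + q - 1) * (Gamma p * Gamma q / Gamma (p + q)))%:E)%E.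
Proof.
move=> p0 q0 sx Fsx incF dF cf f0 Fs Fx.
by rewrite power_kernel_beta// beta_integral_Gamma// -EFinM.
Qed.

End beta_gamma.

(** * Integrating an everywhere existing derivative *)

Section lower_semicontinuous_majorant.
Set Implicit Arguments.
Unset Strict Implicit.
Context {R : realType}.
Local Notation mu := (@lebesgue_measure R).
Implicit Types (D : set R) (f F h : R -> R) (c d t u x e : R).

(** The sum counts the levels dl, ..., n dl that y reaches. The bound by n dl serves the induction:
    if level n + 1 is reached, the sum is at most (n + 1) dl, hence at most y. *)
Let sum_levels_le (dl y : R) n : 0 < dl -> 0 <= y ->
  \sum_(k < n) dl * (k.+1%:R * dl <= y)%R%:R <= Num.min y (n%:R * dl).
Proof.
move=> d0 y0; elim: n => [|n IH]; first by rewrite big_ord0 mul0r le_min y0 lexx.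
rewrite big_ord_recr/=; move: IH; rewrite !le_min => /andP[h1 h2].
have [h|h] := leP (n.+1%:R * dl) y; rewrite ?mulr1 ?mulr0 ?addr0; last first.
  by rewrite h1 (le_trans h2)// ler_pM2r// ler_nat.
have e : n.+1%:R * dl = n%:R * dl + dl by rewrite -natr1; ring.
by rewrite e lerD2r h2 (le_trans _ h)// e lerD2r.
Qed.

(* g is the sum of dl over open supersets, of nearly the same measure, of the
   superlevel sets {h >= k dl}, k >= 1. *)
Lemma lower_semicontinuous_majorant D h (dl e : R) :
  measurable D -> (mu D < +oo)%E -> measurable_fun D h ->
  (forall t, D t -> 0 <= h t) -> 0 < dl -> 0 < e ->
  exists g : R -> \bar R, [/\ measurable_fun setT g, forall t, (0 <= g t)%E,
    (\int[mu]_(t in D) g t <= \int[mu]_(t in D) (h t)%:E + e%:E)%E &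
    forall t, D t -> \forall u \near t, ((h t - dl)%:E <= g u)%E].
Proof.
move=> mD Doo mh h0 dl0 e0.
pose E k := D `&` [set t | k.+1%:R * dl <= h t].
have mE k : measurable (E k).
  rewrite /E; have := mh mD `[k.+1%:R * dl, +oo[%classic (measurable_itv _).
  by rewrite (_ : _ @^-1` _ = [set t | k.+1%:R * dl <= h t])//;
    apply/seteqP; split=> t /=; rewrite in_itv/= andbT.
have Eoo k : (mu (E k) < +oo)%E.
  by apply: le_lt_trans Doo; apply: le_measure; rewrite ?inE; [exact: mE|exact: mD|exact: subIsetl].
(* [g] counts [U k] with weight dl, so the excess measure allowed to [U k] is divided by dl; the
   weighted excesses e / 2^(k + 1) then add up to e. *)
have ek k : 0 < e / (2 ^ k.+1)%:R / dl by rewrite !divr_gt0// ltr0n expn_gt0.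
have /choice[U HU] k := lebesgue_regularity_outer (mE k) (Eoo k) (ek k).
have mU k : measurable (U k) by apply: open_measurable; case: (HU k).
pose g t : \bar R := (\sum_(0 <= k <oo) (dl * \1_(U k) t)%:E)%E.
have p0 A t : 0 <= dl * \1_A t :> R by rewrite mulr_ge0// ltW.
have g0 k t : (0 <= (dl * \1_(U k) t)%:E)%E by rewrite lee_fin.
have mg k A : measurable_fun A (fun t => (dl * \1_(U k) t)%:E).
  by apply: measurable_funTS; apply/measurable_EFinP; apply: measurable_funM.
exists g; split.
- by apply: ge0_emeasurable_sum => // k _.
- by move=> t; apply: nneseries_ge0.
- rewrite /g integral_nneseries//; last by move=> k; exact: mg.
  apply: (@le_trans _ _ (\sum_(0 <= k <oo) ((dl%:E * mu (E k)) + (e / (2 ^ k.+1)%:R)%:E))%E).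
    apply: lee_nneseries => // k _.
      by move=> _; apply: integral_ge0.
    rewrite (_ : \int[mu]_(t in D) _ = dl%:E * mu (U k `&` D))%E; last first.
      under eq_integral do rewrite EFinM.
      rewrite ge0_integralZl//= ?integral_indic//.
      + exact: mU.
      + by apply/measurable_EFinP; apply: measurable_indic (mU k).
      + by rewrite lee_fin ltW.
    have [oU EU UE] := HU k.
    apply: (@le_trans _ _ (dl%:E * (mu (E k) + mu (U k `\` E k)))%E).
      rewrite lee_pmul2l//.
      apply: (@le_trans _ _ (mu (E k `|` (U k `\` E k)))).
        apply: le_measure; rewrite ?inE//.
        + by apply: measurableI => //; exact: mU.
        + by apply: measurableU; [exact: mE|apply: measurableD; [exact: mU|exact: mE]].
        + by rewrite setDUK// => t [].
      apply: measureU2; first exact: mE.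
      by apply: measurableD; [exact: mU|exact: mE].
    rewrite ge0_muleDr// leeD2l//.
    have -> : (e / (2 ^ k.+1)%:R)%:E = (dl%:E * (e / (2 ^ k.+1)%:R / dl)%:E)%E.
      by rewrite -EFinM; congr EFin; field; rewrite gt_eqF//= pnatr_eq0 -lt0n expn_gt0.
    by rewrite lee_pmul2l// ltW.
  rewrite nneseriesD//; last 2 first.
  - by move=> k _; rewrite mule_ge0// lee_fin ltW.
  - by move=> k _; rewrite lee_fin divr_ge0// ltW.
  apply: leeD; last first.
    exact: (epsilon_trick0 xpredT (ltW e0)).
  have -> : (\sum_(0 <= k <oo) dl%:E * mu (E k) =
     \int[mu]_(t in D) \sum_(0 <= k <oo) (dl * \1_(E k) t)%:E)%E.
    rewrite integral_nneseries//=.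
    - apply: eq_eseriesr => k _.
      under eq_integral do rewrite EFinM.
      rewrite ge0_integralZl//= ?integral_indic//.
      + by congr (_ * mu _)%E; rewrite setIidl//; exact: subIsetl.
      + exact: mE.
      + by apply/measurable_EFinP; apply: measurable_indic (mE k).
      + by rewrite lee_fin ltW.
    - move=> k; apply: measurable_funTS; apply/measurable_EFinP; apply: measurable_funM => //.
      apply: measurable_indic (mE k).
    - by move=> k t _; rewrite lee_fin.
  apply: ge0_le_integral => //.
  - by move=> t _; apply: nneseries_ge0 => k _ _; rewrite lee_fin.
  - apply: ge0_emeasurable_sum => // k.
    + by move=> t _ _; rewrite lee_fin.
    + move=> _; apply: measurable_funTS; apply/measurable_EFinP; apply: measurable_funM => //.
      apply: measurable_indic (mE k).
  - exact/measurable_EFinP.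
  - move=> t Dt; apply: lime_le.
      by apply: is_cvg_nneseries => k _ _; rewrite lee_fin.
    near=> n; rewrite sumEFin lee_fin big_mkord.
    have /(le_trans _) : Num.min (h t) (n%:R * dl) <= h t by rewrite ge_min lexx.
    apply; apply: le_trans (sum_levels_le n dl0 (h0 _ Dt)).
    apply: ler_sum => k _; rewrite indicE.
    rewrite ler_wpM2l ?(ltW dl0)// ler_nat; case: (boolP (t \in E k)) => // /[!inE] -[_ /= ->].
    by [].
(* The point t lies in the first n sets [E k], hence in the intersection of the first n open sets
   [U k]; on that neighbourhood g >= n dl > h t - dl. *)
- move=> t Dt; pose n := Num.truncn (h t / dl).
  have hn : n%:R * dl <= h t < n.+1%:R * dl.
    have hd0 : 0 <= h t / dl by rewrite divr_ge0 ?h0// ltW.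
    have := truncn_itv hd0; rewrite -/n.
    by rewrite ler_pdivlMr// ltr_pdivrMr.
  have : \forall u \near t, forall k : 'I_n, U k u.
    apply: (@filter_forall R 'I_n (fun (k : 'I_n) u => U k u) (nbhs t) _) => k; have [oU EU _] := HU k.
    apply: open_nbhs_nbhs; split => //; apply: EU; split => //=.
    case/andP: hn => + _; apply: le_trans; rewrite ler_pM2r// ler_nat.
    exact: ltn_ord.
  apply: filterS => u Uu.
  apply: (@le_trans _ _ (\sum_(0 <= k < n) (dl * \1_(U k) u)%:E)%E); last first.
    exact: nneseries_lim_ge.
  rewrite big_mkord sumEFin lee_fin (eq_bigr (fun=> dl)); last first.
    by move=> k _; rewrite indicE mem_set ?mulr1//; exact: Uu.
  rewrite sumr_const card_ord -mulr_natl.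
  case/andP: hn => _; rewrite -natr1 mulrDl mul1r => /ltW; lra.
Unshelve. all: end_near. Qed.

End lower_semicontinuous_majorant.

Section FTC_everywhere_derivable.
Set Implicit Arguments.
Unset Strict Implicit.
Context {R : realType}.
Local Notation mu := (@lebesgue_measure R).
Implicit Types (D : set R) (f F h : R -> R) (c d t u x e : R).

(** Dominated convergence, with |f| as the dominating function. Once f is truncated from below,
    adding n makes it nonnegative, as [lower_semicontinuous_majorant] demands. *)
Let truncated_integral_le D f e : measurable D -> mu.-integrable D (EFin \o f) ->
  0 < e -> exists n,
  mu.-integrable D (fun t => (Num.max (f t) (- n%:R))%:E) /\
  (\int[mu]_(t in D) (Num.max (f t) (- n%:R))%:E <=
    \int[mu]_(t in D) (f t)%:E + e%:E)%E.
Proof.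
move=> mD fi e0; have mf := measurable_int _ fi.
pose fn n t := (Num.max (f t) (- n%:R))%:E.
have mfn n : measurable_fun D (fn n).
  apply/measurable_EFinP; apply: measurable_maxr; last exact: measurable_cst.
  exact/measurable_EFinP.
have cfn : {ae mu, forall t, D t -> fn ^~ t @ \oo --> (EFin \o f) t}.
  apply: aeW => t _; apply: cvg_near_cst; near=> n; rewrite /fn /=.
  congr EFin; apply/max_idPl; rewrite lerNl.
  apply: (le_trans (ler_norm _)); rewrite normrN.
  by near: n; exact: nbhs_infty_ger.
have fnf n t : (`|fn n t| <= (abse \o (EFin \o f)) t)%E.
  rewrite /fn /= lee_fin ler_norml le_max ge_max ler_norm.
  by rewrite lerNnormlW// (le_trans _ (normr_ge0 _))// oppr_le0.
have ifn n : mu.-integrable D (fn n).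
  by apply: (@le_integrable _ _ _ mu D mD _ _ (mfn n) _ fi) => t _; exact: fnf.
have dfn : {ae mu, forall t, forall n, D t -> (`|fn n t| <= (abse \o (EFin \o f)) t)%E}.
  by apply: aeW => t n _; exact: fnf.
have [_ _ cvgf] := @dominated_convergence _ _ _ mu D mD _ _ _ mfn mf cfn (integrable_abse fi) dfn.
have foo : (\int[mu]_(t in D) (EFin \o f) t)%E \is a fin_num by exact: integrable_fin_num.
apply: contrapT => /forallNP H0.
have H n : ~ (\int[mu]_(t in D) fn n t <= \int[mu]_(t in D) (f t)%:E + e%:E)%E.
  by move=> ?; apply: (H0 n); split => //; exact: ifn.

have : (\int[mu]_(t in D) (f t)%:E + e%:E <= \int[mu]_(t in D) (f t)%:E)%E.
  rewrite -[leRHS](cvg_lim (@ereal_hausdorff R) cvgf).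
  apply: lime_ge; first by apply/cvg_ex; eexists; exact: cvgf.
  by near=> n; rewrite ltW// ltNge; apply/negP/H.
by rewrite leNgt lteDl// lte_fin e0.
Unshelve. all: end_near. Qed.

(* With g a lower semicontinuous majorant of f + N up to e, the inequality
   F x - F c <= int_[c, x] g + (2 e - N) (x - c) propagates from left to right:
   the supremum s of the x for which it holds on [c, d] satisfies it, and if s < d
   it still holds slightly beyond s, where g >= f s + N - e. *)
Lemma right_derivative_le_integral_eps c d F f e : c < d ->
  {within `[c, d], continuous F} ->
  (forall t, c <= t < d -> (F u - F t) / (u - t) @[u --> t^'+] --> f t) ->
  mu.-integrable `[c, d] (EFin \o f) -> 0 < e ->
  ((F d - F c)%:E <= \int[mu]_(t in `[c, d]) (f t)%:E + (2 * e + 2 * e * (d - c))%:E)%E.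
Proof.
move=> cd cF dF fi e0; pose D : set R := `[c, d]%classic.
have mD : measurable D by exact: measurable_itv.
have muD : mu D = (d - c)%:E by rewrite lebesgue_measure_itv/= lte_fin cd EFinB.
have [n [fi_n fn]] := truncated_integral_le mD fi e0.
set N : R := n%:R in fn fi_n.
pose h t := Num.max (f t) (- N) + N.
have h0 t : 0 <= h t by rewrite /h -lerBlDr sub0r le_max lexx orbT.
have fh t : f t <= h t - N by rewrite /h addrK le_max lexx.
have mf : measurable_fun D f by apply/measurable_EFinP; exact: measurable_int fi.
have mh : measurable_fun D h.
  by apply: measurable_funD => //; apply: measurable_maxr.
have [g [mg g0 gh hg]] := lower_semicontinuous_majorant mD
  (ltac:(by rewrite muD ltry) : (mu D < +oo)%E) mh (fun t _ => h0 t) e0 e0.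
pose W x := (\int[mu]_(t in `[c, x]) g t)%E.
have Wle x u : x <= u -> (W x <= W u)%E.
  move=> xu; apply: ge0_subset_integral => //; first exact: measurable_funTS.
  by apply: subset_itvl; rewrite bnd_simp.
have fhD : (\int[mu]_(t in D) (h t)%:E =
    \int[mu]_(t in D) (Num.max (f t) (- N))%:E + (N * (d - c))%:E)%E.
  rewrite /h; under eq_integral do rewrite EFinD.
  rewrite integralD//=.
    by rewrite integral_cst// EFinM; congr (_ + _ * _)%E; exact: muD.
  apply/integrableP; split => //.
  by rewrite integral_cst//= -[X in (_ * X)%E]/(mu D) muD -EFinM ltry.

have Woo x : x <= d -> (W x < +oo)%E.
  move=> xd; apply: (le_lt_trans (Wle _ _ xd)); apply: (le_lt_trans gh).
  rewrite fhD; apply: lte_add_pinfty; last by rewrite ltry.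
  apply: lte_add_pinfty; last by rewrite ltry.
  apply: (le_lt_trans fn); apply: lte_add_pinfty; last by rewrite ltry.
  by have := @integrable_fin_num _ _ _ mu D mD _ fi; rewrite fin_numE ltey => /andP[].
pose S := [set x | c <= x <= d /\ ((F x - F c + (N - 2 * e) * (x - c))%:E <= W x)%E].
have Sc : S c.
  split; first by rewrite lexx ltW.
  by rewrite !subrr mulr0 addr0; apply: integral_ge0.
have ubS : ubound S d by move=> x [/andP[]].
have supS : has_sup S by split; [exists c|exists d].
set s := sup S.
have cs : c <= s by apply: ub_le_sup => //; exists d.
have sd : s <= d by apply: ge_sup => //; exists c.
(* Continuity of [F] and monotonicity of [W] suffice: if the inequality failed at s, its left-hand
   side would exceed W s at all x close to s, yet for x <= s in [S] it is at most W x <= W s. *)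
have Ss : S s.
  split; first by rewrite cs.
  rewrite leNgt; apply/negP => Ws.
  have /subspace_continuousP /(_ s) := cF; rewrite /= in_itv/= cs sd => /(_ isT) cFs.
  have Wsf : W s \is a fin_num by rewrite ge0_fin_numE ?Woo ?integral_ge0.
  rewrite -(fineK Wsf) lte_fin in Ws.
  pose phi x := F x - F c + (N - 2 * e) * (x - c).
  have cphi : phi x @[x --> within D (nbhs s)] --> phi s.
    apply: cvgD; first by apply: cvgB => //; exact: cvg_cst.
    apply: cvgMr; apply: cvgB; last exact: cvg_cst.
    by apply: cvg_within; exact: cvg_id.
  have /(cvgr_gt _ cphi) : fine (W s) < phi s by [].
  rewrite /prop_near1 /within /= => /nbhs_ballP[r/= r0 Hr].
  have [x [/andP[cx xd] Wx] sx] := sup_adherent r0 supS.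
  have xs : x <= s by apply: ub_le_sup; [exists d|split; rewrite ?cx].
  have Dx : D x by rewrite /D/= in_itv/= cx xd.
  have /Hr /(_ Dx) : ball s r x.
    by rewrite /ball/= ger0_norm ?subr_ge0// ltrBlDr -ltrBlDl.
  apply/negP; rewrite -leNgt.
  rewrite -lee_fin (fineK Wsf).
  exact: le_trans (Wle _ _ xs).
have sE : s = d.
  apply/eqP; rewrite eq_le sd leNgt; apply/negP => sd'.
  (* One e is the error of the difference quotient of F at s, the other the gap dl = e between h s
     and [g] near s; together they are the 2 e in the definition of [S]. *)
  have [u [su ud Fu gu]] : exists u, [/\ s < u, u <= d, F u - F s <= (f s + e) * (u - s) &
      forall v, s < v <= u -> ((h s - e)%:E <= g v)%E].
    have sD : D s by rewrite /D/= in_itv/= cs sd.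
    have /nbhs_ballP[r/= r0 Hr] := hg s sD.
    have : c <= s < d by rewrite cs sd'.
    move=> /dF Fs.
    have fse : f s < f s + e by rewrite ltrDl.
    have : \forall u \near s^'+, [/\ s < u, u <= d, F u - F s <= (f s + e) * (u - s) & u < s + r].
      near=> u; have su : s < u by [].
      split => //.
      - by near: u; exact: nbhs_right_le.
      - rewrite -ler_pdivrMr ?subr_gt0//.
        by near: u; apply: (cvgr_le _ Fs).
      - by near: u; apply: nbhs_right_lt; rewrite ltrDl.
    move=> /filter_ex[u [su ud Fu usr]]; exists u; split => // v /andP[sv vu].
    apply: Hr; rewrite /ball/= ltr0_norm ?subr_lt0// opprB ltrBlDl.
    exact: le_lt_trans usr.
  suff /(ub_le_sup (ex_intro _ d ubS)) : S u by rewrite leNgt su.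
  split; first by rewrite ud (le_trans cs)// ltW.
  have [_ FW] := Ss.
  have -> : W u = (W s + \int[mu]_(t in `]s, u]) g t)%E.
    rewrite /W -ge0_integral_setU//=.
    - by rewrite -itv_bndbnd_setU// bnd_simp// ltW.
    - exact: measurable_funTS.
    - apply/disj_setPS => t /= []; rewrite !in_itv/= => /andP[_ ts] /andP[st _].
      by move: st; rewrite ltNge ts.
  have hgu : (((h s - e) * (u - s))%:E <= \int[mu]_(t in `]s, u]) g t)%E.
    have [hs|hs] := leP (h s - e) 0.
      apply: (@le_trans _ _ 0%E); last exact: integral_ge0.
      by rewrite lee_fin mulr_le0_ge0// subr_ge0 ltW.
    apply: (@le_trans _ _ (\int[mu]_(t in `]s, u]) (h s - e)%:E)%E).
      by rewrite integral_cst//= lebesgue_measure_itv/= lte_fin su -EFinB -EFinM.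
    apply: ge0_le_integral => //.
    - by move=> t _; rewrite lee_fin ltW.
    - exact: measurable_funTS.
  apply: le_trans (leeD FW hgu).
  rewrite -EFinD lee_fin.
  have us : 0 < u - s by rewrite subr_gt0.
  have : (f s + e) * (u - s) <= (h s - N + e) * (u - s).
    by rewrite ler_wpM2r ?(ltW us)// lerD2r.
  nra.
(* At s = d the terms N (d - c) cancel; of the constant 2 e, one e is due to the truncation and one
   to the integral of [g]. *)
have [_] := Ss; rewrite sE => /le_trans /(_ gh); rewrite fhD.
move/le_trans; move/(_ _ (leeD (leeD fn (lexx _)) (lexx _))).
have /fineK <- := @integrable_fin_num _ _ _ mu D mD _ fi.
rewrite -!EFinD !lee_fin; lra.
Unshelve. all: end_near. Qed.

End FTC_everywhere_derivable.

Section derivable_within.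
Set Implicit Arguments.
Unset Strict Implicit.
Context {R : realType}.
Local Notation mu := (@lebesgue_measure R).
Implicit Types (D : set R) (f F h : R -> R) (a b c d t u x e : R).

Lemma derivable_within_cvg D F x : derivable_within D F x ->
  F u @[u --> within D (nbhs x)] --> F x.
Proof.
move=> dF; apply/cvgrPdist_lt => e e0.
have : (diff_quotient F x u * (u - x)) @[u --> within D x^'] --> 0.
  rewrite -(mulr0 (deriv_within D F x)); apply: cvgM => //.
  rewrite -(subrr x); apply: cvg_within_filter; apply: cvg_within_filter.
  by apply: cvgB; [exact: cvg_id|exact: cvg_cst].
move=> /cvgrPdist_lt /(_ e e0).
apply: (@filterS _ (nbhs x)) => u Hu Du.
have [->|ux] := eqVneq u x; first by rewrite subrr normr0.
move: (Hu ux Du); rewrite sub0r normrN /diff_quotient divfK ?subr_eq0//.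
by rewrite distrC.
Qed.

Lemma is_derive_deriv_within D F x : D° x -> derivable_within D F x ->
  is_derive x 1 F (deriv_within D F x).
Proof.
move=> Dx dF.
have H : h^-1 *: (F (h *: 1 + x) - F x) @[h --> 0^'] --> deriv_within D F x.
  apply/cvgrPdist_lt => e e0.
  have /cvgrPdist_lt /(_ e e0) Fx : diff_quotient F x u @[u --> within D x^'] --> deriv_within D F x by [].
  have /nbhs_ballP[r/= r0 Hr] : nbhs x ([set u | u != x -> D u ->
      `|deriv_within D F x - diff_quotient F x u| < e] `&` D) by exact: filterI.
  apply/nbhs_ballP; exists r => //= h; rewrite /ball/= sub0r normrN => hr h0.
  have [] := Hr (h + x); first by rewrite /ball/= opprD addrCA subrr addr0 normrN.
  move=> /= H /H; rewrite /diff_quotient addrK -[h *: 1]/(h * 1) mulr1 mulrC; apply.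
  by rewrite -subr_eq0 addrK.
apply: DeriveDef; first by apply/cvg_ex; exists (deriv_within D F x).
exact: cvg_lim H.
Qed.

Lemma cvg_at_right_deriv_within D F x : (\forall u \near x^'+, D u) ->
  derivable_within D F x -> diff_quotient F x u @[u --> x^'+] --> deriv_within D F x.
Proof.
move=> Dx dF; apply: cvg_trans dF => P; rewrite /= /nbhs/= => Hp.
move: Dx Hp; apply: (@filterS2 _ (nbhs x)) => u /= Du Pu xu; apply: Pu; [|exact: Du].
by rewrite gt_eqF.
Qed.

Lemma cvg_at_left_deriv_within D F x : (\forall u \near x^'-, D u) ->
  derivable_within D F x -> diff_quotient F x u @[u --> x^'-] --> deriv_within D F x.
Proof.
move=> Dx dF; apply: cvg_trans dF => P; rewrite /= /nbhs/= => Hp.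
move: Dx Hp; apply: (@filterS2 _ (nbhs x)) => u /= Du Pu ux; apply: Pu; [|exact: Du].
by rewrite lt_eqF.
Qed.

Let right_derivative_le_Rintegral c d F f : c < d ->
  {within `[c, d], continuous F} ->
  (forall t, c <= t < d -> (F u - F t) / (u - t) @[u --> t^'+] --> f t) ->
  mu.-integrable `[c, d] (EFin \o f) ->
  F d - F c <= \int[mu]_(t in `[c, d]) f t.
Proof.
move=> cd cF dF fi; apply/ler_addgt0Pr => e e0.
have K0 : 0 < 2 + 2 * (d - c) by rewrite addr_gt0// mulr_gt0// subr_gt0.
have := right_derivative_le_integral_eps cd cF dF fi (divr_gt0 e0 K0).
have /fineK <- : (\int[mu]_(t in `[c, d]) (f t)%:E)%E \is a fin_num.
  exact: integrable_fin_num.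
rewrite -EFinD lee_fin => /le_trans; apply; rewrite /Rintegral lerD2l.
by rewrite le_eqVlt; apply/orP; left; apply/eqP; field; rewrite gt_eqF.
Qed.

Lemma right_derivative_Rintegral c d F f : c < d ->
  {within `[c, d], continuous F} ->
  (forall t, c <= t < d -> (F u - F t) / (u - t) @[u --> t^'+] --> f t) ->
  mu.-integrable `[c, d] (EFin \o f) ->
  F d - F c = \int[mu]_(t in `[c, d]) f t.
Proof.
move=> cd cF dF fi; apply/eqP; rewrite eq_le right_derivative_le_Rintegral//=.
(* The reverse inequality is the same one for - F and - f. *)
rewrite -lerN2 opprB.
have -> : - (\int[mu]_(t in `[c, d]) f t) = \int[mu]_(t in `[c, d]) (- f t).
  have := @RintegralZl _ _ R mu _ f (-1) (measurable_itv `[c, d]) fi.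
  by under eq_Rintegral do rewrite mulN1r; rewrite mulN1r => ->.
have := @right_derivative_le_Rintegral c d (\- F) (\- f) cd.
rewrite /= opprK addrC; apply.
- by move=> t; apply: cvgN; exact: cF.
- move=> t /dF h; rewrite (_ : (fun u => _) = (fun u => - ((F u - F t) / (u - t)))).
    exact: cvgN.
  by apply/funext => u; rewrite -mulNr opprB opprK addrC.
- have := integrableN fi; by [].
Qed.

(** Only the right limit l of [F] is known at a. The formula is applied on [c, x] and c tends to a,
    the integral over [a, c] vanishing in the limit. *)
Lemma Rintegral_deriv_within a b F l : a < b ->
  (forall x, x \in `]a, b] -> derivable_within `]a, b] F x) ->
  mu.-integrable `]a, b[ (EFin \o deriv_within `]a, b] F) ->
  F x @[x --> a^'+] --> l ->
  forall x, x \in `]a, b] ->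
  F x - l = \int[mu]_(t in `]a, x[) deriv_within `]a, b] F t.
Proof.
move=> ab dF fi Fl x; rewrite in_itv/= => /andP[ax xb].
(* The formula on [c, x] takes right difference quotients at points t < x <= b, and there this
   extension by zero agrees with the derivative. *)
pose f := deriv_within `]a, b] F \_ `]a, b[.
have fi' : mu.-integrable setT (EFin \o f).
  rewrite /f -restrict_EFin.
  by apply: (@integrable_mkcond _ _ R mu _ _ (measurable_itv `]a, b[)).1.
have fiS (i : interval R) : mu.-integrable [set` i] (EFin \o f).
  by apply: integrableS fi'.
pose I c := \int[mu]_(t in `[a, c]) f t.
have FI c : a < c < x -> F c = F x - I x + I c.
  move=> /andP[ac cx].
  have -> : I x = I c + \int[mu]_(t in `[c, x]) f t.
    have := @Rintegral_itvB R f (BLeft a) (BRight x) c (fiS _).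
    rewrite !bnd_simp (ltW ac) (ltW cx) => /(_ isT isT).
    rewrite Rintegral_itv_obnd_cbnd; last exact: fiS.
    by rewrite -/(I x) -/(I c) => <-; rewrite addrC subrK.
  rewrite -(@right_derivative_Rintegral _ _ F)//; first by ring.
  - apply/subspace_continuousP => t; rewrite /= in_itv/= => /andP[ct tx].
    have := derivable_within_cvg (dF t _).
    rewrite in_itv/= (lt_le_trans ac ct) (le_trans tx xb) => /(_ isT).
    apply: cvg_trans; apply: cvg_app => P; apply: (@filterS _ (nbhs t)) => u Pu cux.
    apply: Pu; move: cux; rewrite /= !in_itv/= => /andP[cu ux].
    by rewrite (lt_le_trans ac cu) (le_trans ux xb).
  - move=> t /andP[ct tx].
    rewrite /f patchE mem_set/=; last first.
      by rewrite in_itv/= (lt_le_trans ac ct) (lt_le_trans tx xb).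
    apply: cvg_at_right_deriv_within.
      near=> u; rewrite /= in_itv/=; apply/andP; split.
        by rewrite (lt_le_trans ac)// (le_trans ct)//.
      by near: u; apply: nbhs_right_le; rewrite (lt_le_trans tx).
    by apply: dF; rewrite in_itv/= (lt_le_trans ac ct) (le_trans (ltW tx)).
have Icvg : I c @[c --> a^'+] --> 0.
  have := parameterized_integral_cvg_left ab (fiS `[a, b]).
  exact: cvg_at_right_filter.
have -> : l = F x - I x.
  apply: (@cvg_unique _ (@Rhausdorff R) (F c @[c --> a^'+])) => //.
  have IF : F x - I x + I c @[c --> a^'+] --> F x - I x + 0.
    by apply: cvgD => //; exact: cvg_cst.
  rewrite addr0 in IF; apply: cvg_trans IF; apply: near_eq_cvg; near=> c.
  suff /FI -> : a < c < x by [].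
  by apply/andP; split => //; near: c; exact: nbhs_right_lt.
rewrite opprB addrC subrK /I -Rintegral_itv_bndo_bndc; last exact: fiS.
rewrite -Rintegral_itv_obnd_cbnd; last exact: fiS.
apply: eq_Rintegral => t; rewrite inE/= in_itv/= => /andP[at_ tx].
by rewrite /f patchE mem_set//= in_itv/= at_ (lt_le_trans tx).
Unshelve. all: end_near. Qed.

End derivable_within.

(** * Fractional integrals with respect to psi *)

Section psi.
Set Implicit Arguments.
Unset Strict Implicit.
Context {R : realType}.
Local Notation mu := (@lebesgue_measure R).
Variables (a b : R) (psi : R -> R).
Hypotheses (ab : a < b) (psi_C1 : C1_on a b psi)
  (psi_incr : {in `[a, b] &, {homo psi : s t / s < t}})
  (dpsi_neq0 : forall x, x \in `[a, b] -> deriv_within `[a, b] psi x != 0).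
Local Notation dpsi := (dpsi a b psi).
Implicit Types (p q s t u x : R) (h : R -> R).

Lemma psi_lt s t : a <= s -> s < t -> t <= b -> psi s < psi t.
Proof.
by move=> as_ st tb; apply: psi_incr; rewrite ?in_itv/= ?as_ ?tb ?(le_trans as_ (ltW st)) ?(le_trans (ltW st)).
Qed.

Lemma psi_le s t : a <= s -> s <= t -> t <= b -> psi s <= psi t.
Proof.
by move=> as_; rewrite le_eqVlt => /predU1P[->//|st tb]; exact/ltW/psi_lt.
Qed.

Lemma psi_cvg_within t : a <= t <= b -> psi u @[u --> within `[a, b] (nbhs t)] --> psi t.
Proof. by move=> tab; apply: derivable_within_cvg; apply: psi_C1.1. Qed.

Lemma psi_cvg_at_right t : a <= t < b -> psi u @[u --> t^'+] --> psi t.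
Proof.
move=> /andP[at_ tb]; apply: cvg_trans (psi_cvg_within _); last by rewrite at_ ltW.
apply: cvg_app => P HP.
have : \forall u \near t^'+, u <= b by exact: nbhs_right_le.
move: HP; apply: (@filterS2 _ (nbhs t)) => u /= Pu ub tu; apply: Pu.
by rewrite in_itv/= ub// (le_trans at_) ?ltW.
Qed.

Lemma psi_cvg_at_left t : a < t <= b -> psi u @[u --> t^'-] --> psi t.
Proof.
move=> /andP[at_ tb]; apply: cvg_trans (psi_cvg_within _); last by rewrite tb ltW.
apply: cvg_app => P HP.
have : \forall u \near t^'-, a <= u by exact: nbhs_left_ge.
move: HP; apply: (@filterS2 _ (nbhs t)) => u /= Pu au ut; apply: Pu.
by rewrite in_itv/= au// (le_trans _ tb) ?ltW.
Qed.

(** The difference quotients are nonnegative, taken from the right for t < b and from the left at b;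
    the derivative, being nonzero, is then positive. *)
Lemma dpsi_gt0 t : a <= t <= b -> 0 < dpsi t.
Proof.
move=> /andP[at_ tb]; rewrite lt_neqAle eq_sym dpsi_neq0 ?in_itv/= ?at_//=.
have dF : derivable_within `[a, b] psi t by apply: psi_C1.1; rewrite in_itv/= at_.
have [tb'|bt] := ltP t b.
  apply: (cvgr_to_ge (cvg_at_right_deriv_within _ dF)); near=> u.
    rewrite /= in_itv/=; apply/andP; split; first by rewrite (le_trans at_)// ltW.
    by near: u; exact: nbhs_right_le.
  have tu : t < u by [].
  rewrite /diff_quotient divr_ge0 ?subr_ge0 ?(ltW tu)// ltW// psi_lt//.
  by near: u; exact: nbhs_right_le.
have {}at_ : a < t by exact: lt_le_trans bt.
apply: (cvgr_to_ge (cvg_at_left_deriv_within _ dF)); near=> u.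
  rewrite /= in_itv/=; apply/andP; split; last by rewrite (le_trans _ tb)// ltW.
  by near: u; exact: nbhs_left_ge.
have ut : u < t by [].
rewrite /diff_quotient -mulrNN -invrN !opprB divr_ge0 ?subr_ge0 ?(ltW ut)// ltW// psi_lt//.
by near: u; exact: nbhs_left_ge.
Unshelve. all: end_near. Qed.

Lemma is_derive_psi t : a < t < b -> is_derive t 1 psi (dpsi t).
Proof.
move=> tab; apply: is_derive_deriv_within.
  by rewrite interior_itv_bnd/= in_itv.
by apply: psi_C1.1; apply: subset_itv_oo_cc; rewrite in_itv.
Qed.

Lemma dpsi_cvg_within t : a <= t <= b -> dpsi u @[u --> within `[a, b] (nbhs t)] --> dpsi t.
Proof. by move=> tab; have /subspace_continuousP := psi_C1.2; apply. Qed.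

Lemma within_oo_nbhs t (D : set R) (f : R -> R) : `]a, b[ `<=` D -> a < t < b ->
  f u @[u --> within D (nbhs t)] --> f t -> {for t, continuous f}.
Proof.
move=> sD tab; apply: cvg_trans; apply: cvg_app => P.
have : \forall u \near t, u \in `]a, b[ by apply: near_in_itvoo; rewrite in_itv.
by apply: (@filterS2 _ (nbhs t)) => u uab Pu; apply: Pu; exact: sD.
Qed.

Lemma dpsi_continuous t : a < t < b -> {for t, continuous dpsi}.
Proof.
move=> tab; have [? ?] := andP tab.
apply: (@within_oo_nbhs _ `[a, b]) => //; first exact: subset_itv_oo_cc.
by apply: dpsi_cvg_within; rewrite !ltW.
Qed.

Lemma psi_continuous t : a < t < b -> {for t, continuous psi}.
Proof.
move=> tab; have [? ?] := andP tab.
apply: (@within_oo_nbhs _ `[a, b]) => //; first exact: subset_itv_oo_cc.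
by apply: psi_cvg_within; rewrite !ltW.
Qed.

Lemma psi_kernel p q s x : 0 < p -> 0 < q -> a <= s -> s < x -> x <= b ->
  (\int[mu]_(t in `]s, x[)
     ((psi x - psi t) `^ (p - 1) * (psi t - psi s) `^ (q - 1) * dpsi t)%:E =
   ((psi x - psi s) `^ (p + q - 1) * (Gamma p * Gamma q / Gamma (p + q)))%:E)%E.
Proof.
move=> p0 q0 as_ sx xb.
have sub t : t \in `]s, x[ -> a < t < b.
  by rewrite in_itv/= => /andP[st tx]; rewrite (le_lt_trans as_)// (lt_le_trans tx).
apply: power_kernel_integral => //.
- exact: psi_lt.
- by move=> t u /sub/andP[t1 t2] /sub/andP[u1 u2] tu; rewrite psi_lt// ltW.
- by move=> t /sub; exact: is_derive_psi.
- by move=> t /sub; exact: dpsi_continuous.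
- by move=> t /sub/andP[t1 t2]; rewrite ltW// dpsi_gt0// !ltW.
- by apply: psi_cvg_at_right; rewrite as_ (lt_le_trans sx).
- by apply: psi_cvg_at_left; rewrite xb (le_lt_trans as_).
Qed.

Lemma measurable_dpsi : measurable_fun `]a, b[ dpsi.
Proof.
apply: open_continuous_measurable_fun; first exact: interval_open.
by move=> t; rewrite inE/= in_itv/=; exact: dpsi_continuous.
Qed.

Lemma measurable_psi : measurable_fun `]a, b[ psi.
Proof.
apply: open_continuous_measurable_fun; first exact: interval_open.
by move=> t; rewrite inE/= in_itv/=; exact: psi_continuous.
Qed.

End psi.

(** * Composition of fractional integrals by Fubini *)

Section semigroup.
Set Implicit Arguments.
Unset Strict Implicit.
Context {R : realType}.
Local Notation mu := (@lebesgue_measure R).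
Variables (a b : R) (psi : R -> R).
Hypotheses (ab : a < b) (psi_C1 : C1_on a b psi)
  (psi_incr : {in `[a, b] &, {homo psi : s t / s < t}})
  (dpsi_neq0 : forall x, x \in `[a, b] -> deriv_within `[a, b] psi x != 0).
Local Notation dpsi := (dpsi a b psi).
Implicit Types (p q s t u x : R) (h : R -> R).

Let kernel := psi_kernel ab psi_C1 psi_incr dpsi_neq0.

Let V t : R := (dpsi \_ `]a, b[) t.

Let V_ge0 t : 0 <= V t.
Proof.
rewrite /V patchE; case: ifPn => //; rewrite inE/= in_itv/= => /andP[at_ tb].
by rewrite ltW// (dpsi_gt0 ab psi_C1)// !ltW.
Qed.

Let measurable_V : measurable_fun setT V.
Proof.
by apply/(measurable_restrictT _ (measurable_itv _)); exact: measurable_dpsi.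
Qed.

(* Constant extension of psi outside [a, b], making measurability global. *)
Let P t := psi (Num.max a (Num.min b t)).

Let PE t : a <= t <= b -> P t = psi t.
Proof. by move=> /andP[at_ tb]; rewrite /P (min_idPr tb) (max_idPr at_). Qed.

Let measurable_P : measurable_fun setT P.
Proof.
apply: nondecreasing_measurable => // s t st.
apply: (psi_le psi_incr).
- by rewrite le_max lexx.
- rewrite ge_max le_max lexx/= le_max le_min !ge_min lexx st/=.
  by rewrite !orbT.
- by rewrite ge_max (ltW ab) ge_min lexx.
Qed.

(** Vanishes unless t < x: the triangle s < t < x is carried by the integrand, and Fubini is applied
    on the whole plane. *)
Let K p x t : R := if t < x then (P x - P t) `^ (p - 1) else 0.

Let K_ge0 p x t : 0 <= K p x t.
Proof. by rewrite /K; case: ifP => // _; exact: powR_ge0. Qed.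

Let measurable_K p : measurable_fun setT (fun z : R * R => K p z.1 z.2).
Proof.
apply: measurable_fun_ifT.
- exact: measurable_fun_ltr.
- apply: (@measurableT_comp _ _ _ _ _ _ (fun u : R => u `^ (p - 1))).
    exact: measurable_powR.
  by apply: measurable_funB; apply: (measurableT_comp measurable_P).
- exact: measurable_cst.
Qed.

Let measurable_Kr p x : measurable_fun setT (K p x).
Proof. exact: (measurableT_comp (measurable_K p) (measurable_pair1 x)). Qed.

(** This is the exact value of the inner integral in t, as given by the Beta integral. *)
Let kernel_bound p q x s : R :=
  if (a < s) && (s < x) then
    (P x - P s) `^ (p + q - 1) * (Gamma p * Gamma q / Gamma (p + q)) else 0.

Let kernel_bound_ge0 p q x s : 0 < p -> 0 < q -> 0 <= kernel_bound p q x s.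
Proof.
move=> p0 q0; rewrite /kernel_bound; case: ifP => // _.
by rewrite mulr_ge0 ?powR_ge0// divr_ge0 ?mulr_ge0// ltW// Gamma_gt0// addr_gt0.
Qed.

Let integral_K p q x s : 0 < p -> 0 < q -> x <= b -> a < s ->
  (\int[mu]_t (V t * K p x t * K q t s)%:E = (kernel_bound p q x s)%:E)%E.
Proof.
move=> p0 q0 xb as_; rewrite /kernel_bound as_/=.
have [sx|xs] := ltP s x; last first.
  apply: integral0_eq => t _; rewrite /K.
  case: ltP => [tx|_]; last by rewrite mulr0 mul0r.
  case: ltP => [st|_]; last by rewrite mulr0.
  by have := lt_le_trans (lt_trans st tx) xs; rewrite ltxx.
have ax : a < x by exact: lt_trans sx.
rewrite !PE ?xb ?(ltW ax)// ?(ltW as_) ?(le_trans (ltW sx) xb)//.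
rewrite -kernel//; last exact: ltW.
rewrite [RHS]integral_mkcond; apply: eq_integral => t _.
rewrite patchE mem_setE in_itv/= /K; case: ltP => [tx|_]; last first.
  by rewrite andbF mulr0 mul0r.
case: ltP => [st|_]; last by rewrite mulr0.
have at_ : a < t by exact: lt_trans st.
have tb : t < b by exact: lt_le_trans xb.
rewrite /V patchE mem_set/= ?in_itv/= ?at_//.
rewrite !PE ?xb ?(ltW at_) ?(ltW tb) ?(ltW as_)//=.
- by rewrite -mulrA mulrC.
- by rewrite ltW// (lt_trans st).
- by rewrite ltW// (lt_trans at_).
Qed.

Let measurable_kernel_bound p q x : measurable_fun setT (kernel_bound p q x).
Proof.
apply: measurable_fun_ifT; last exact: measurable_cst.
  by apply: measurable_and; apply: measurable_fun_ltr.
apply: measurable_funM; last exact: measurable_cst.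
apply: (@measurableT_comp _ _ _ _ _ _ (fun u : R => u `^ (p + q - 1))).
  exact: measurable_powR.
exact: measurable_funB.
Qed.

Lemma measurable_psi_kernel r x : measurable_fun `]a, b[ (fun t => (psi x - psi t) `^ r).
Proof.
apply: (@measurableT_comp _ _ _ _ _ _ (fun u : R => u `^ r)).
  exact: measurable_powR.
by apply: measurable_funB; [exact: measurable_cst|exact: measurable_psi].
Qed.

(** For p >= 1 the kernel is bounded by its value at t = a. *)
Lemma integrable_frac_integrand_ge1 p h x : 1 <= p ->
  mu.-integrable `]a, b[ (fun t => (dpsi t * h t)%:E) -> x \in `]a, b] ->
  mu.-integrable `]a, x[ (EFin \o frac_integrand a b psi p h x).
Proof.
move=> p1 hi; rewrite in_itv/= => /andP[ax xb].
have sub : `]a, x[ `<=` (`]a, b[ : set R).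
  by apply: subset_itvl; rewrite bnd_simp.
have hix : mu.-integrable `]a, x[ (fun t => (dpsi t * h t)%:E).
  exact: integrableS hi.
have mh : measurable_fun `]a, x[ (fun t => dpsi t * h t).
  by apply/measurable_EFinP; exact: measurable_int hix.
have E : (fun t => (frac_integrand a b psi p h x t)%:E) =
    (fun t => ((psi x - psi t) `^ (p - 1) * (dpsi t * h t))%:E).
  by apply/funext => t; rewrite /frac_integrand mulrCA mulrA.
rewrite /comp E.
apply: (@le_integrable _ _ _ mu _ (measurable_itv _) _
   (fun t => (((psi x - psi a) `^ (p - 1))%:E * (dpsi t * h t)%:E)%E)).
- apply/measurable_EFinP; apply: measurable_funM => //.
  exact: measurable_funS (measurable_psi_kernel _ _).
- move=> t /=; rewrite in_itv/= => /andP[at_ tx].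
  rewrite !normrM lee_fin !(ger0_norm (powR_ge0 _ _)) ler_wpM2r//.
  have tb : t <= b by exact/ltW/(lt_le_trans tx).
  apply: ge0_ler_powR; rewrite ?subr_ge0// ?nnegrE ?subr_ge0.
  + by rewrite (psi_le psi_incr)// ltW.
  + by rewrite (psi_le psi_incr)// ltW.
  + by rewrite lerB// (psi_le psi_incr)// ltW.
- exact: integrableZl.
Qed.

(** Fubini for psi'(t) K_p(x, t) K_q(t, s) psi'(s) h(s). Integrating in t first leaves a multiple of
    (psi x - psi s)^(p + q - 1), bounded in s thanks to p + q >= 1; so the double integral converges
    absolutely at every x. The integrability comes with the identity because linearity of the outer
    integral relies on it later. *)
Let semigroup p q h x : 0 < p -> 0 < q -> 1 <= p + q ->
  mu.-integrable `]a, b[ (fun t => (dpsi t * h t)%:E) -> x \in `]a, b] ->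
  mu.-integrable `]a, x[ (EFin \o frac_integrand a b psi p (frac_int a b psi q h) x) /\
  frac_int a b psi p (frac_int a b psi q h) x = frac_int a b psi (p + q) h x.
Proof.
move=> p0 q0 pq1 hi xab; have := xab; rewrite in_itv/= => /andP[ax xb].
pose H := (fun t => dpsi t * h t) \_ `]a, b[.
have Hi : mu.-integrable setT (EFin \o H).
  rewrite /H -restrict_EFin.
  by apply: (@integrable_mkcond _ _ R mu _ _ (measurable_itv `]a, b[)).1.
have mH : measurable_fun setT H by apply/measurable_EFinP; exact: measurable_int Hi.
pose f (z : R * R) : R := V z.1 * K p x z.1 * K q z.1 z.2 * H z.2.
have mf : measurable_fun setT (EFin \o f).
  apply/measurable_EFinP; apply: measurable_funM; last exact: (measurableT_comp mH).
  apply: measurable_funM; last exact: measurable_K.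
  by apply: measurable_funM; [exact: (measurableT_comp measurable_V)|
    exact: (measurableT_comp (measurable_Kr p x))].
have mVK s : measurable_fun setT (fun t => V t * K p x t * K q t s).
  apply: measurable_funM; last exact: (measurableT_comp (measurable_K q) (measurable_pair2 s)).
  by apply: measurable_funM.
have VK0 s t : 0 <= V t * K p x t * K q t s by rewrite !mulr_ge0.
have iVK s : a < s -> mu.-integrable setT (fun t => (V t * K p x t * K q t s)%:E).
  move=> as_; apply/integrableP; split; first by apply/measurable_EFinP; exact: mVK.
  under eq_integral do rewrite /= ger0_norm//.
  by rewrite integral_K// ltry.
have H0 s : s <= a -> H s = 0.
  by move=> sa; rewrite /H patchE memNset//= in_itv/= ltNge sa.
have int1 s : (\int[mu]_t (f (t, s))%:E = (kernel_bound p q x s * H s)%:E)%E.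
  rewrite /f/=; have [as_|/H0 ->] := ltP a s; last first.
    by rewrite mulr0 integral0_eq// => t _; rewrite mulr0.
  under eq_integral do rewrite EFinM.
  by rewrite integralZr//=; [rewrite integral_K// EFinM|exact: iVK].
have int2 s : (\int[mu]_t `|(f (t, s))%:E| = (kernel_bound p q x s * `|H s|)%:E)%E.
  rewrite /f/=; have [as_|/H0 ->] := ltP a s; last first.
    by rewrite normr0 mulr0 integral0_eq// => t _; rewrite mulr0 normr0.
  under eq_integral do rewrite normrM (ger0_norm (VK0 _ _)) EFinM.
  rewrite ge0_integralZr//=.
  - by rewrite integral_K// EFinM.
  - by apply/measurable_EFinP; exact: mVK.
  - by move=> t _; rewrite lee_fin.
have Gpq : 0 <= Gamma p * Gamma q / Gamma (p + q).
  by rewrite divr_ge0 ?mulr_ge0// ltW// Gamma_gt0// addr_gt0.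
have fi : (mu \x mu)%E.-integrable setT (EFin \o f).
  apply: (@integrable21ltyP _ _ _ _ R mu mu _ mf).2.
  pose C := (psi x - psi a) `^ (p + q - 1) * (Gamma p * Gamma q / Gamma (p + q)).
  have C0 : 0 <= C by rewrite mulr_ge0// powR_ge0.
  apply: (@le_lt_trans _ _ (\int[mu]_s (C%:E * `|(H s)%:E|))%E).
    under eq_integral do rewrite int2.
    apply: ge0_le_integral => //.
    - by move=> s _; rewrite lee_fin mulr_ge0// kernel_bound_ge0.
    - apply/measurable_EFinP; apply: measurable_funM; first exact: measurable_kernel_bound.
      exact: measurableT_comp.
    - by apply/measurable_EFinP; apply: measurable_funM => //; exact: measurableT_comp.
    - move=> s _; rewrite -EFinM lee_fin ler_wpM2r// /kernel_bound.
      case: ifP => // /andP[as_ sx]; rewrite ler_wpM2r//.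
      rewrite !PE ?xb ?(ltW ax)// ?(ltW as_) ?(le_trans (ltW sx) xb)//.
      apply: ge0_ler_powR; rewrite ?subr_ge0// ?nnegrE ?subr_ge0.
      + by rewrite (psi_le psi_incr)// ltW.
      + by rewrite (psi_le psi_incr)// ltW.
      + by rewrite lerB// (psi_le psi_incr)// ?(le_trans (ltW sx) xb)// ltW.
  have /integrableP[_ Hoo] := Hi.
  rewrite ge0_integralZl//=; last first.
    by apply/measurable_EFinP; exact: measurableT_comp.
  have : (\int[mu]_x `|(H x)%:E| \is a fin_num)%E.
    by rewrite ge0_fin_numE//; exact: integral_ge0.
  by move=> /fineK <-; rewrite -EFinM ltry.
have := @Fubini _ _ _ _ R mu mu _ fi.
under [in RHS]eq_integral do rewrite /comp int1.
move=> F12.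
pose g := frac_integrand a b psi p (frac_int a b psi q h) x.
pose phi t := (\int[mu]_s (K q t s * H s)%:E)%E.
(* The inner integral need not converge for every t, so measurability is obtained from the
   nonnegative case, applied to the positive and negative parts. *)
have mphi : measurable_fun setT phi.
  have mKH : measurable_fun setT (fun z : R * R => (K q z.1 z.2 * H z.2)%:E).
    apply/measurable_EFinP; apply: measurable_funM; first exact: measurable_K.
    exact: (measurableT_comp mH).
  pose KH (z : R * R) : \bar R := (K q z.1 z.2 * H z.2)%:E.
  have -> : phi = (fun t => fubini_F mu KH^\+ t - fubini_F mu KH^\- t)%E.
    apply/funext => t; rewrite /phi integralE /fubini_F.
    congr (_ - _)%E; apply: eq_integral => s _ /=.
      by rewrite -[RHS]/((KH^\+ \o pair t) s)%E -funepos_comp.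
    by rewrite -[RHS]/((KH^\- \o pair t) s)%E -funeneg_comp.
  apply: emeasurable_funB; apply: measurable_fun_fubini_tonelli_F => //.
    exact: measurable_funepos.
  exact: measurable_funeneg.
have gphi t : (g \_ `]a, x[) t = V t * K p x t * ((Gamma q)^-1 * fine (phi t)).
  rewrite patchE; case: ifPn => [|tax].
    rewrite inE/= in_itv/= => /andP[at_ tx].
    have tb : t < b by exact: lt_le_trans xb.
    rewrite /g /frac_integrand /frac_int gt_eqF//.
    rewrite /V patchE mem_set/= ?in_itv/= ?at_//.
    rewrite {1}/K tx !PE ?xb ?(ltW ax) ?(ltW at_) ?(ltW tb)//.
    congr (_ * (_ * _)); rewrite Rintegral_mkcond; congr fine.
    apply: eq_integral => s _; congr EFin.
    rewrite patchE mem_setE in_itv/= /K /H; case: (ltP s t) => st; last by rewrite andbF mul0r.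
    rewrite andbT patchE mem_setE in_itv/= (lt_trans st tb) andbT.
    case: ltP => as_; last by rewrite mulr0.
    have sb : s < b by exact: lt_trans tb.
    by rewrite !PE ?(ltW at_) ?(ltW tb) ?(ltW as_) ?(ltW sb)// mulrCA mulrA.
  move: tax; rewrite notin_setE/= in_itv/= => /negP; rewrite negb_and -!leNgt => /orP[ta|xt].
    by rewrite /V patchE memNset/= ?mul0r// in_itv/= ltNge ta.
  by rewrite /K ltNge xt/= mulr0 !mul0r.
(* For almost every t the section of [f] is integrable. Where the outer factor is nonzero it can be
   divided out, so [phi t] is finite and [fine] loses nothing; where it is zero both sides
   vanish. *)
have gE : ae_eq mu setT (fun t => ((g \_ `]a, x[) t)%:E)
    (fun t => ((Gamma q)^-1%:E * \int[mu]_s (f (t, s))%:E)%E).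
  have := @ae_integrable1 _ _ _ _ R mu mu _ fi.
  apply: filterS => t ft _; rewrite gphi.
  have fE s : (f (t, s))%:E = ((V t * K p x t)%:E * (K q t s * H s)%:E)%E.
    by rewrite -EFinM mulrA.
  have [c0|c0] := eqVneq (V t * K p x t) 0.
    by rewrite c0 mul0r integral0_eq ?mule0// => s _; rewrite fE c0 mul0e.
  have iKH : mu.-integrable setT (fun s => (K q t s * H s)%:E).
    have := @integrableZl _ _ R mu _ measurableT (V t * K p x t)^-1 _ ft.
    apply: eq_integrable => // s _; rewrite /= fE -!EFinM; congr EFin.
    by rewrite mulrA mulVf ?mul1r.
  under eq_integral do rewrite fE.
  rewrite integralZl// -(@fineK _ (\int[mu]_s _)%E); last exact: integrable_fin_num.
  by rewrite -!EFinM -/(phi t); congr EFin; rewrite mulrCA.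
have iF : mu.-integrable setT (fun t => \int[mu]_s (f (t, s))%:E)%E.
  exact: (@integrable_fubini_F _ _ _ _ R mu mu _ fi).
have iF0 := integrable_frac_integrand_ge1 pq1 hi xab.
have mg : measurable_fun setT (fun t => ((g \_ `]a, x[) t)%:E).
  under eq_fun do rewrite gphi.
  apply/measurable_EFinP; apply: measurable_funM.
    by apply: measurable_funM; [exact: measurable_V|exact: measurable_Kr].
  apply: measurable_funM => //.
  by apply: measurableT_comp => //; exact: mphi.
have iGF : mu.-integrable setT (fun t => (Gamma q)^-1%:E * \int[mu]_s (f (t, s))%:E)%E.
  exact: (@integrableZl _ _ R mu _ measurableT _ _ iF).
split.
  apply: (@integrable_mkcond _ _ R mu _ _ (measurable_itv `]a, x[)).2.
  rewrite restrict_EFin; apply/integrableP; split; first exact: mg.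
  rewrite (@ae_eq_integral _ _ R mu setT (fun t => `|(Gamma q)^-1%:E * \int[mu]_s (f (t, s))%:E|)%E)//.
  - by have /integrableP[] := iGF.
  - exact: measurableT_comp.
  - by apply: measurableT_comp => //; exact: measurable_int iGF.
  - by apply: filterS gE => t gt tT; rewrite -(gt tT).
rewrite {1}/frac_int gt_eqF// -/g.
have -> : \int[mu]_(t in `]a, x[) g t = (Gamma q)^-1 *
    ((Gamma p * Gamma q / Gamma (p + q)) * \int[mu]_(t in `]a, x[) frac_integrand a b psi (p + q) h x t).
  rewrite Rintegral_mkcond {1}/Rintegral (ae_eq_integral _ _ _ _ _ gE)//; last first.
    exact: measurable_int iGF.
  rewrite integralZl// fineM//; last exact: integrable_fin_num.
  congr (_ * _); rewrite F12 -RintegralZl//.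
  rewrite [RHS]Rintegral_mkcond; congr fine; apply: eq_integral => s _; congr EFin.
  rewrite patchE mem_setE in_itv/= /kernel_bound; case: ifP => [/andP[as_ sx]|]; last by rewrite mul0r.
  have sb : s < b by exact: lt_le_trans xb.
  rewrite !PE ?xb ?(ltW ax) ?(ltW as_) ?(ltW sb)//.
  rewrite /H patchE mem_set/= ?in_itv/= ?as_// /frac_integrand; ring.
rewrite /frac_int gt_eqF ?addr_gt0// mulrA mulrA; congr (_ * _).
have [Gp Gq Gpq0] : [/\ Gamma p != 0, Gamma q != 0 & Gamma (p + q) != 0].
  by split; apply: Gamma_neq0 => //; exact: addr_gt0.
by move: (Gamma p) (Gamma q) (Gamma (p + q)) Gp Gq Gpq0 => gp gq gpq *; field; apply/and3P.
Qed.

Lemma frac_int_semigroup p q h x : 0 < p -> 0 < q -> 1 <= p + q ->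
  mu.-integrable `]a, b[ (fun t => (dpsi t * h t)%:E) -> x \in `]a, b] ->
  frac_int a b psi p (frac_int a b psi q h) x = frac_int a b psi (p + q) h x.
Proof. by move=> p0 q0 pq hi xab; have [] := semigroup p0 q0 pq hi xab. Qed.

Lemma integrable_frac_integrand_frac_int p q h x : 0 < p -> 0 < q -> 1 <= p + q ->
  mu.-integrable `]a, b[ (fun t => (dpsi t * h t)%:E) -> x \in `]a, b] ->
  mu.-integrable `]a, x[ (EFin \o frac_integrand a b psi p (frac_int a b psi q h) x).
Proof. by move=> p0 q0 pq hi xab; have [] := semigroup p0 q0 pq hi xab. Qed.

End semigroup.

(** * Weighted spaces and powers of psi - psi(a) *)

Section weighted.
Set Implicit Arguments.
Unset Strict Implicit.
Context {R : realType}.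
Local Notation mu := (@lebesgue_measure R).
Variables (a b : R) (psi : R -> R).
Hypotheses (ab : a < b) (psi_C1 : C1_on a b psi)
  (psi_incr : {in `[a, b] &, {homo psi : s t / s < t}})
  (dpsi_neq0 : forall x, x \in `[a, b] -> deriv_within `[a, b] psi x != 0).
Local Notation dpsi := (dpsi a b psi).
Local Notation w t := (psi t - psi a).
Local Notation frac_int := (frac_int a b psi).
Local Notation frac_integrand := (frac_integrand a b psi).
Local Notation weighted_C := (weighted_C a b psi).
Implicit Types (p q r s t u x g c : R) (h k : R -> R).

Let kernel := psi_kernel ab psi_C1 psi_incr dpsi_neq0.

Lemma w_gt0 t : a < t <= b -> 0 < w t.
Proof. by move=> /andP[? ?]; rewrite subr_gt0 (psi_lt psi_incr). Qed.

Lemma eq_frac_int p h k x : p != 0 -> (forall t, a < t < x -> h t = k t) ->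
  frac_int p h x = frac_int p k x.
Proof.
move=> p0 hk; rewrite /Defs.frac_int (negbTE p0); congr (_ * _).
apply: eq_Rintegral => t; rewrite inE/= in_itv/= => /hk.
by rewrite /Defs.frac_integrand => ->.
Qed.

Lemma frac_int_lin p h k c d x : p != 0 ->
  mu.-integrable `]a, x[ (EFin \o frac_integrand p h x) ->
  mu.-integrable `]a, x[ (EFin \o frac_integrand p k x) ->
  frac_int p (fun t => c * h t + d * k t) x = c * frac_int p h x + d * frac_int p k x.
Proof.
move=> p0 hi ki; rewrite /Defs.frac_int (negbTE p0).
rewrite [c * _]mulrCA [d * _]mulrCA -mulrDr; congr (_ * _).
rewrite -!RintegralZl// -RintegralD//; last 2 first.
- exact: (@integrableZl _ _ R mu _ (measurable_itv `]a, x[) c _ hi).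
- exact: (@integrableZl _ _ R mu _ (measurable_itv `]a, x[) d _ ki).
by apply: eq_Rintegral => t _; rewrite /Defs.frac_integrand; ring.
Qed.

Lemma le_frac_int p h k x : 0 < p -> a < x <= b ->
  mu.-integrable `]a, x[ (EFin \o frac_integrand p h x) ->
  mu.-integrable `]a, x[ (EFin \o frac_integrand p k x) ->
  (forall t, a < t < x -> `|h t| <= k t) -> `|frac_int p h x| <= frac_int p k x.
Proof.
move=> p0 /andP[ax xb] hi ki hk; rewrite /Defs.frac_int gt_eqF//.
have G0 : 0 < (Gamma p)^-1 by rewrite invr_gt0 Gamma_gt0.
rewrite normrM (gtr0_norm G0) ler_pM2l//.
apply: (le_trans (le_normr_Rintegral _ hi)) => //.
apply: le_Rintegral => //.
  exact: integrable_norm.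
move=> t; rewrite /= in_itv/= => /andP[at_ tx].
rewrite /Defs.frac_integrand normrM ger0_norm.
  by rewrite ler_wpM2l ?hk ?at_// mulr_ge0 ?powR_ge0// ltW// (dpsi_gt0 ab psi_C1)// (ltW at_) ltW// (lt_le_trans tx).
by rewrite mulr_ge0 ?powR_ge0// ltW// (dpsi_gt0 ab psi_C1)// (ltW at_) ltW// (lt_le_trans tx).
Qed.

Lemma measurable_dpsi_kernel p x : x <= b ->
  measurable_fun `]a, x[ (fun t => dpsi t * (psi x - psi t) `^ (p - 1)).
Proof.
move=> xb; apply: (@measurable_funS _ _ _ _ `]a, b[) => //.
  by apply: subset_itvl; rewrite bnd_simp.
by apply: measurable_funM; [exact: measurable_dpsi|exact: measurable_psi_kernel].
Qed.

Lemma measurable_w_powR r : measurable_fun `]a, b[ (fun t => (w t) `^ r).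
Proof.
apply: (@measurableT_comp _ _ _ _ _ _ (fun u : R => u `^ r)).
  exact: measurable_powR.
by apply: measurable_funB; [exact: measurable_psi|exact: measurable_cst].
Qed.

Let kernel_w p q x : 0 < p -> 0 < q -> a < x <= b ->
  (\int[mu]_(t in `]a, x[) (frac_integrand p (fun t => (w t) `^ (q - 1)) x t)%:E =
   ((w x) `^ (p + q - 1) * (Gamma p * Gamma q / Gamma (p + q)))%:E)%E.
Proof.
move=> p0 q0 /andP[ax xb]; rewrite -kernel//.
by apply: eq_integral => t _; rewrite /Defs.frac_integrand; congr EFin; ring.
Qed.

Lemma integrable_frac_integrand_w p q x : 0 < p -> 0 < q -> a < x <= b ->
  mu.-integrable `]a, x[ (EFin \o frac_integrand p (fun t => (w t) `^ (q - 1)) x).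
Proof.
move=> p0 q0 /[dup] axb /andP[ax xb]; apply/integrableP; split.
  apply/measurable_EFinP; apply: measurable_funM; first exact: measurable_dpsi_kernel.
  apply: measurable_funS (measurable_w_powR _) => //.
  by apply: subset_itvl; rewrite bnd_simp.
apply: (@le_lt_trans _ _ (\int[mu]_(t in `]a, x[)
    (frac_integrand p (fun t => (w t) `^ (q - 1)) x t)%:E)%E); last first.
  by rewrite kernel_w// ltry.
rewrite le_eqVlt; apply/orP; left; apply/eqP; apply: eq_integral => t.
rewrite inE/= in_itv/= => /andP[at_ tx]; rewrite ger0_norm//.
by rewrite !mulr_ge0 ?powR_ge0// ltW// (dpsi_gt0 ab psi_C1)// (ltW at_) ltW// (lt_le_trans tx).
Qed.

Lemma frac_int_w p q x : 0 < p -> 0 < q -> a < x <= b ->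
  frac_int p (fun t => (w t) `^ (q - 1)) x =
  Gamma q / Gamma (p + q) * (w x) `^ (p + q - 1).
Proof.
move=> p0 q0 axb; rewrite /Defs.frac_int gt_eqF// /Rintegral kernel_w//=.
have [Gp Gq Gpq0] : [/\ Gamma p != 0, Gamma q != 0 & Gamma (p + q) != 0].
  by split; apply: Gamma_neq0 => //; exact: addr_gt0.
by move: (Gamma p) (Gamma q) (Gamma (p + q)) Gp Gq Gpq0 => gp gq gpq *; field; apply/andP.
Qed.

(** The continuous extension attains its maximum and its minimum on [a, b]; M is the sum of their
    absolute values. *)
Lemma weighted_C_bound g h : weighted_C g h ->
  exists2 M, 0 <= M & forall t, a < t <= b -> `|h t| <= M * (w t) `^ (g - 1).
Proof.
move=> [k [ck hk]].
have [c _ cM] := EVT_max (ltW ab) ck; have [d _ dm] := EVT_min (ltW ab) ck.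
exists (`|k c| + `|k d|) => [|t tab]; first by rewrite addr_ge0.
have [at_ tb] := andP tab.
have w0 := w_gt0 tab.
have -> : h t = k t * (w t) `^ (g - 1).
  rewrite hk ?in_itv/= ?at_// mulrAC -powRD ?(gt_eqF w0) ?implybT//.
  by rewrite (_ : 1 - g + (g - 1) = 0) ?powRr0 ?mul1r//; ring.
rewrite normrM (ger0_norm (powR_ge0 _ _)) ler_wpM2r ?powR_ge0//.
have tab' : t \in `[a, b] by rewrite in_itv/= tb ltW.
have := ler_norm (- k d); have := ler_norm (k c); rewrite normrN.
have := normr_ge0 (k c); have := normr_ge0 (k d).
move: (cM t tab') (dm t tab') => ? ? ? ? ? ?.
by rewrite ler_norml; apply/andP; split; lra.
Qed.

Lemma weighted_C_cvg g h t : weighted_C g h -> a < t <= b ->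
  h u @[u --> within `]a, b] (nbhs t)] --> h t.
Proof.
move=> [k [ck hk]] /[dup] tab /andP[at_ tb].
have /subspace_continuousP /(_ t) := ck.
rewrite /= in_itv/= tb (ltW at_) => /(_ isT) ckt.
have w0 := w_gt0 tab.
have hE u : a < u <= b -> h u = k u * (w u) `^ (g - 1).
  move=> /[dup] uab /andP[au ub]; rewrite hk ?in_itv/= ?au// mulrAC -powRD; last first.
    by rewrite (gt_eqF (w_gt0 uab)) implybT.
  by rewrite (_ : 1 - g + (g - 1) = 0) ?powRr0 ?mul1r//; ring.
have sub : within `]a, b] (nbhs t) `=>` within `[a, b] (nbhs t).
  move=> Q; apply: (@filterS _ (nbhs t)) => u Qu uab; apply: Qu.
  exact: subset_itv_oc_cc.
rewrite hE//; apply: (@cvg_trans _ (k u * (w u) `^ (g - 1) @[u --> within `]a, b] (nbhs t)])).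
  apply: near_eq_cvg; near=> u; rewrite hE//.
  have : `]a, b]%classic u by near: u; exact: withinT.
  by rewrite /= in_itv.
apply: cvgM; first by apply: cvg_trans ckt; exact: cvg_app.
have wt : w u @[u --> within `]a, b] (nbhs t)] --> w t.
  apply: cvgB; last exact: cvg_cst.
  apply: (@cvg_trans _ (psi u @[u --> within `[a, b] (nbhs t)])); first exact: cvg_app.
  by apply: psi_cvg_within => //; rewrite tb ltW.
apply: (@cvg_comp _ _ _ (fun u => w u) (fun z => z `^ (g - 1)) _ _ _ wt).
exact: continuous_powR.
Unshelve. all: end_near. Qed.

Lemma weighted_C_measurable g h : weighted_C g h -> measurable_fun `]a, b[ h.
Proof.
move=> wh; apply: open_continuous_measurable_fun; first exact: interval_open.
move=> t; rewrite inE/= in_itv/= => /[dup] tab /andP[at_ tb].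
apply: (@within_oo_nbhs _ a b _ `]a, b]) => //; first exact: subset_itv_oo_oc.
by apply: weighted_C_cvg wh _; rewrite at_ ltW.
Qed.

(** Domination by M w^(g - 1), whose integral against the kernel is a finite Beta integral. *)
Lemma weighted_C_integrable g p h x : 0 < g -> 0 < p -> weighted_C g h -> a < x <= b ->
  mu.-integrable `]a, x[ (EFin \o frac_integrand p h x).
Proof.
move=> g0 p0 wh /[dup] axb /andP[ax xb]; have [M M0 hM] := weighted_C_bound wh.
apply: (@le_integrable _ _ _ mu _ (measurable_itv _) _
   (fun t => (M%:E * (frac_integrand p (fun t => (w t) `^ (g - 1)) x t)%:E)%E)).
- apply/measurable_EFinP; apply: measurable_funM; first exact: measurable_dpsi_kernel.
  apply: measurable_funS (weighted_C_measurable wh) => //.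
  by apply: subset_itvl; rewrite bnd_simp.
- move=> t /=; rewrite in_itv/= => /andP[at_ tx].
  have tab : a < t <= b by rewrite at_ ltW// (lt_le_trans tx).
  have D0 : 0 <= dpsi t * (psi x - psi t) `^ (p - 1).
    by rewrite mulr_ge0 ?powR_ge0// ltW// (dpsi_gt0 ab psi_C1)// (ltW at_); case/andP: tab.
  rewrite lee_fin /Defs.frac_integrand normrM (ger0_norm D0).
  have r0 : 0 <= M * (dpsi t * (psi x - psi t) `^ (p - 1) * (w t) `^ (g - 1)).
    by rewrite mulr_ge0// mulr_ge0// powR_ge0.
  rewrite [leRHS]ger0_norm// mulrCA ler_wpM2l//.
  exact: hM.
- apply: integrableZl => //.
  exact: integrable_frac_integrand_w.
Qed.

Lemma weighted_C_integrable1 g h : 0 < g -> weighted_C g h ->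
  mu.-integrable `]a, b[ (fun t => (dpsi t * h t)%:E).
Proof.
move=> g0 wh; have := @weighted_C_integrable g 1 h b g0 ltr01 wh.
rewrite ab lexx => /(_ isT); apply: eq_integrable => // t _ /=.
by rewrite /Defs.frac_integrand subrr powRr0 mulr1.
Qed.

End weighted.

(** * The Volterra equation and the comparison *)

Section volterra.
Set Implicit Arguments.
Unset Strict Implicit.
Context {R : realType}.
Local Notation mu := (@lebesgue_measure R).
Variables (a b : R) (psi : R -> R).
Hypotheses (ab : a < b) (psi_C1 : C1_on a b psi)
  (psi_incr : {in `[a, b] &, {homo psi : s t / s < t}})
  (dpsi_neq0 : forall x, x \in `[a, b] -> deriv_within `[a, b] psi x != 0).
Local Notation dpsi := (dpsi a b psi).
Local Notation w t := (psi t - psi a).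
Local Notation frac_int := (frac_int a b psi).
Local Notation frac_integrand := (frac_integrand a b psi).
Local Notation weighted_C := (weighted_C a b psi).
Implicit Types (p q r s t u x c : R) (h k y : R -> R).

Let semigroup := frac_int_semigroup ab psi_C1 psi_incr dpsi_neq0.
Let wint := weighted_C_integrable ab psi_C1 psi_incr dpsi_neq0.
Let wint1 := weighted_C_integrable1 ab psi_C1 psi_incr dpsi_neq0.

Lemma frac_int1 h x : frac_int 1 h x = \int[mu]_(t in `]a, x[) (dpsi t * h t).
Proof.
rewrite /Defs.frac_int oner_eq0 Gamma1 invr1 mul1r; apply: eq_Rintegral => t _.
by rewrite /Defs.frac_integrand subrr powRr0 mulr1.
Qed.

(** The weight has exponent 0 here. This brings I^(1-gamma) y and I^1 G, which have limits at a,
    under the integrability results for weighted functions. *)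
Lemma weighted_C1 h (l : R) :
  (forall t, a < t <= b -> h u @[u --> within `]a, b] (nbhs t)] --> h t) ->
  h t @[t --> a^'+] --> l -> weighted_C 1 h.
Proof.
move=> ch hl; pose k t := if t == a then l else h t.
have kh t : a < t -> k t = h t by move=> at_; rewrite /k gt_eqF.
exists k; split; last first.
  move=> t; rewrite in_itv/= => /andP[at_ _].
  by rewrite kh// subrr powRr0 mul1r.
apply/(continuous_within_itvP _ ab); split.
- move=> t; rewrite in_itv/= => /[dup] tab /andP[at_ tb].
  have : {for t, continuous h}.
    apply: (@within_oo_nbhs _ a b _ `]a, b]) => //; first exact: subset_itv_oo_oc.
    by apply: ch; rewrite at_ ltW.
  rewrite /continuous_at kh//; apply: cvg_trans; apply: near_eq_cvg; near=> u.
  have au : a < u by near: u; exact: lt_nbhsr.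
  by rewrite kh.
- rewrite {2}/k eqxx; apply: cvg_trans hl; apply: near_eq_cvg; near=> u.
  by rewrite kh.
- rewrite kh//.
  have cb : h u @[u --> within `]a, b] (nbhs b)] --> h b by apply: ch; rewrite ab lexx.
  apply: cvg_trans cb; apply: (@cvg_trans _ (h u @[u --> b^'-])).
    apply: near_eq_cvg; near=> u.
    have au : a < u by near: u; exact: nbhs_left_gt.
    by rewrite kh.
  apply: cvg_app => Q HQ.
  have : \forall u \near b^'-, a < u by exact: nbhs_left_gt.
  move: HQ; apply: (@filterS2 _ (nbhs b)) => u /= Qu au ub; apply: Qu.
  by rewrite in_itv/= au// ltW.
Unshelve. all: end_near. Qed.

Lemma hilfer_ivp_volterra (alpha beta gamma c : R) (f : R -> R -> R) y :
  0 < alpha -> alpha < 1 -> 0 <= beta -> beta <= 1 ->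
  gamma = alpha + beta * (1 - alpha) ->
  weighted_C gamma (fun x => f x (y x)) ->
  hilfer_ivp a b psi alpha beta gamma f c y ->
  forall x, a < x <= b ->
  frac_int 1 y x = c / Gamma gamma * frac_int 1 (fun t => (w t) `^ (gamma - 1)) x
    + frac_int 1 (frac_int alpha (fun t => f t (y t))) x.
Proof.
move=> al0 al1 be0 be1 gE wf [[wy hex _] yE yc] x axb.
have [ax xb] := andP axb.
set phi := fun t => f t (y t) in wf *.
have g0 : 0 < gamma by rewrite gE ltr_wpDr// mulr_ge0// subr_ge0 ltW.
have g1 : gamma <= 1.
  by rewrite gE -lerBrDl ler_piMl// subr_ge0 ltW.
have bE : (1 - beta) * (1 - alpha) = 1 - gamma by rewrite gE; ring.
have dE : beta * (1 - alpha) = gamma - alpha by rewrite gE; ring.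
pose F := frac_int (1 - gamma) y.
pose G := psi_deriv a b psi F.
have hexE t : a < t <= b -> [/\ frac_int_exists a b psi (1 - gamma) y t,
    derivable_within `]a, b] F t & frac_int_exists a b psi (gamma - alpha) G t].
  by move: hex; rewrite /hilfer_exists bE dE => hex' tab; apply: hex'; rewrite in_itv.
have dp0 t : a < t <= b -> dpsi t != 0.
  by move=> /andP[at_ tb]; rewrite gt_eqF// (dpsi_gt0 ab psi_C1)// ltW.
have dGE t : a < t <= b -> dpsi t * G t = deriv_within `]a, b] F t.
  by move=> /dp0 t0; rewrite /G /psi_deriv mulrA divff// mul1r.
have dF t : a < t <= b -> derivable_within `]a, b] F t.
  by move=> tab; have [] := hexE t tab.
have GE t : a < t <= b -> frac_int (gamma - alpha) G t = phi t.
  move=> tab; have tI : t \in `]a, b] by rewrite in_itv.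
  by have := yE t tI; rewrite /hilfer bE dE.
(* If gamma = alpha, then G is f(., y) itself on ]a, b]. Otherwise the fractional integral of G of
   order gamma - alpha exists at b, and its kernel is removed by multiplying with the bounded
   function (psi b - psi t)^(1 - (gamma - alpha)). *)
have iG : mu.-integrable `]a, b[ (fun t => (dpsi t * G t)%:E).
  have [ga|ga] := eqVneq gamma alpha.
    apply: eq_integrable (wint1 g0 wf) => //= t; rewrite inE/= in_itv/= => /andP[at_ tb].
    by rewrite -GE ?at_ ?ltW// /Defs.frac_int ga subrr eqxx.
  have abb : a < b <= b by rewrite ab lexx.
  have [_ _] := hexE b abb; rewrite /frac_int_exists subr_eq0 => /(_ ga) iG.
  have r0 : 0 <= 1 - (gamma - alpha) by rewrite opprB addrA subr_ge0 ler_wpDr// ltW.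
  have E t : a < t < b -> dpsi t * G t =
      (psi b - psi t) `^ (1 - (gamma - alpha)) * frac_integrand (gamma - alpha) G b t.
    move=> /andP[at_ tb]; have bt : 0 < psi b - psi t.
      by rewrite subr_gt0 (psi_lt psi_incr)// ltW.
    have KK : (psi b - psi t) `^ (1 - (gamma - alpha)) * (psi b - psi t) `^ (gamma - alpha - 1) = 1.
      rewrite -powRD ?(gt_eqF bt) ?implybT//.
      have -> : 1 - (gamma - alpha) + (gamma - alpha - 1) = 0 by ring.
      exact: powRr0.
    by rewrite -[LHS]mul1r -[X in X * _ = _]KK /Defs.frac_integrand; ring.
  apply: (@le_integrable _ _ _ mu _ (measurable_itv _) _
     (fun t => (((w b) `^ (1 - (gamma - alpha)))%:E * (frac_integrand (gamma - alpha) G b t)%:E)%E)).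
  - apply/measurable_EFinP.
    apply: (@eq_measurable_fun _ _ _ _ _
      (fun t => (psi b - psi t) `^ (1 - (gamma - alpha)) * frac_integrand (gamma - alpha) G b t)).
      by move=> t; rewrite inE/= in_itv/= => /E.
    apply: measurable_funM; first exact: measurable_psi_kernel.
    by apply/measurable_EFinP; exact: measurable_int iG.
  - move=> t; rewrite /= in_itv/= => tab; rewrite E// lee_fin.
    rewrite normrM [leRHS]normrM ler_wpM2r// !(ger0_norm (powR_ge0 _ _)).
    have /andP[at_ tb] := tab.
    apply: ge0_ler_powR => //; rewrite ?nnegrE ?subr_ge0.
    + by rewrite (psi_le psi_incr)// ltW.
    + by rewrite (psi_le psi_incr)// ltW.
    + by rewrite lerB// (psi_le psi_incr)// ltW.
  - exact: integrableZl.
have dF' t : t \in `]a, b] -> derivable_within `]a, b] F t.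
  by rewrite in_itv; exact: dF.
have idF : mu.-integrable `]a, b[ (EFin \o deriv_within `]a, b] F).
  apply: eq_integrable iG => // u; rewrite inE/= in_itv/= => /andP[au ub].
  by rewrite /= dGE// au ltW.
have Fc : F t @[t --> a^'+] --> c by exact: yc.
have FG t : a < t <= b -> F t - c = frac_int 1 G t.
  move=> tab; rewrite frac_int1 (Rintegral_deriv_within ab dF' idF Fc) ?in_itv//.
  apply: eq_Rintegral => u; rewrite inE/= in_itv/= => /andP[au ut].
  by rewrite dGE// au ltW// (lt_le_trans ut)//; case/andP: tab.
have wF : weighted_C 1 F.
  by apply: (weighted_C1 (l := c)) => // t tab; exact/derivable_within_cvg/dF.
have w1 : weighted_C 1 (fun=> 1).
  by apply: (weighted_C1 (l := 1)) => [t _|]; exact: cvg_cst.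
(* I^1 G inherits its regularity from F - c, with which it coincides on ]a, b]. *)
have wFc : weighted_C 1 (frac_int 1 G).
  have : weighted_C 1 (fun t => F t - c).
    apply: (@weighted_C1 (fun t => F t - c) (c - c)) => [t tab|].
      by apply: cvgB; [exact/derivable_within_cvg/dF|exact: cvg_cst].
    by apply: cvgB; [exact: Fc|exact: cvg_cst].
  move=> [k [ck kF]]; exists k; split => // t tab; rewrite kF//.
  by rewrite FG//; move: tab; rewrite in_itv.
have xab : x \in `]a, b] by rewrite in_itv.
(* For gamma = 1 the inner operator has order 0 and is the identity; the semigroup law is stated for
   positive orders. *)
have -> : frac_int 1 y x = frac_int gamma F x.
  have [g1E|g1E] := eqVneq gamma 1.
    rewrite g1E; apply: eq_frac_int => [|t _]; first exact: oner_neq0.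
    by rewrite /F g1E subrr /Defs.frac_int eqxx.
  have g1' : 0 < 1 - gamma by rewrite subr_gt0 lt_neqAle g1E.
  by rewrite /F semigroup ?subrKC//; exact: wint1 wy.
have -> : frac_int gamma F x = c * frac_int gamma (fun=> 1) x + 1 * frac_int gamma (frac_int 1 G) x.
  rewrite -frac_int_lin ?gt_eqF//; [|exact: wint|exact: wint].
  apply: eq_frac_int => [|t /andP[at_ tx]]; first by rewrite gt_eqF.
  by rewrite -FG ?at_ ?ltW ?(lt_le_trans tx)//; ring.
rewrite mul1r semigroup ?lerDr ?(ltW g0)//; congr (_ + _).
  (* Both sides equal c w^gamma / Gamma(gamma + 1); the constant 1 is written w^(1 - 1) to fit the
     power rule. *)
  have -> : frac_int gamma (fun=> 1) x = frac_int gamma (fun t => (w t) `^ (1 - 1)) x.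
    by apply: eq_frac_int => [|t _]; rewrite ?gt_eqF// subrr powRr0.
  rewrite !(frac_int_w ab)// Gamma1 [1 + gamma]addrC.
  have [Gg Gg1] : Gamma gamma != 0 /\ Gamma (gamma + 1) != 0.
    by split; apply: Gamma_neq0 => //; exact: addr_gt0.
  by move: (Gamma gamma) (Gamma (gamma + 1)) Gg Gg1 => u v *; field; apply/andP.
rewrite [frac_int 1 (frac_int alpha phi) x]semigroup ?ler_wpDr ?(ltW al0)//; last exact: wint1 wf.
have [ga|ga] := eqVneq gamma alpha.
  rewrite ga addrC; apply: eq_frac_int => [|t /andP[at_ tx]].
    by rewrite gt_eqF// addr_gt0.
  by rewrite -GE ?at_ ?ltW ?(lt_le_trans tx)// /Defs.frac_int ga subrr eqxx.
have ga0 : 0 < gamma - alpha.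
  by rewrite subr_gt0 lt_neqAle eq_sym ga gE lerDl mulr_ge0// subr_ge0 ltW.
(* The order is split so that I^(gamma - alpha) acts on G first and turns it into f(., y). *)
rewrite (_ : gamma + 1 = 1 + alpha + (gamma - alpha)); last by ring.
have a10 : 0 < 1 + alpha by rewrite addr_gt0.
have ag1 : 1 <= 1 + alpha + (gamma - alpha) by rewrite -addrA subrKC lerDl ltW.
rewrite -(semigroup a10 ga0 ag1 iG xab).
apply: eq_frac_int => [|t /andP[at_ tx]]; first by rewrite gt_eqF.
by rewrite GE// at_ ltW// (lt_le_trans tx).
Qed.

End volterra.

(** * From integrals over subintervals to pointwise bounds *)

Section comparison.
Set Implicit Arguments.
Unset Strict Implicit.
Context {R : realType}.
Local Notation mu := (@lebesgue_measure R).
Variables (a b : R) (psi : R -> R).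
Hypotheses (ab : a < b) (psi_C1 : C1_on a b psi)
  (psi_incr : {in `[a, b] &, {homo psi : s t / s < t}})
  (dpsi_neq0 : forall x, x \in `[a, b] -> deriv_within `[a, b] psi x != 0).
Local Notation dpsi := (dpsi a b psi).
Local Notation frac_int := (frac_int a b psi).
Implicit Types (p q r s t x c : R) (h k u v T : R -> R).

Let integrable_dpsi h := mu.-integrable `]a, b[ (fun t => (dpsi t * h t)%:E).

(** If u x > T x, continuity keeps psi' (T - u) below half of its negative value at x on some ]c,
    x[. Yet u and v have the same psi'-weighted integral over ]c, x[, and v <= T makes the integral
    of psi' (T - u) nonnegative. The interval lies to the left of x so that x = b is covered. *)
Let le_of_frac_int1 u v T :
  integrable_dpsi u -> integrable_dpsi v -> integrable_dpsi T ->
  (forall t, a < t <= b -> u s @[s --> within `]a, b] (nbhs t)] --> u t) ->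
  (forall t, a < t <= b -> T s @[s --> within `]a, b] (nbhs t)] --> T t) ->
  (forall x, a < x <= b -> frac_int 1 u x = frac_int 1 v x) ->
  (forall t, a < t <= b -> v t <= T t) ->
  forall x, a < x <= b -> u x <= T x.
Proof.
move=> iu iv iT cu cT uv vT x /[dup] xab /andP[ax xb].
rewrite leNgt; apply/negP => Txu.
pose k t := dpsi t * (T t - u t).
have kx : k x < 0.
  by rewrite /k pmulr_rlt0 ?subr_lt0// (dpsi_gt0 ab psi_C1)// ltW.
have ck : k s @[s --> within `]a, b] (nbhs x)] --> k x.
  apply: cvgM; last by apply: cvgB; [exact: cT|exact: cu].
  apply: (@cvg_trans _ (dpsi s @[s --> within `[a, b] (nbhs x)])); last first.
    by apply: dpsi_cvg_within => //; rewrite xb ltW.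
  apply: cvg_app => Q; apply: (@filterS _ (nbhs x)) => s Qs sab; apply: Qs.
  exact: subset_itv_oc_cc.
have /(cvgr_lt _ ck) : k x < k x / 2 by lra.
rewrite /prop_near1 /within /= => /nbhs_ballP[r/= r0 Hr].
pose c := Num.max ((a + x) / 2) (x - r / 2).
have ac : a < c by rewrite lt_max; apply/orP; left; lra.
have cx : c < x by rewrite gt_max; apply/andP; split; lra.
have rc : x - r < c by rewrite lt_max; apply/orP; right; lra.
have sub : `]c, x[ `<=` (`]a, b[ : set R).
  by move=> t; rewrite /= !in_itv/= => /andP[ct tx]; rewrite (lt_trans ac)// (lt_le_trans tx).
have split_int h : integrable_dpsi h ->
    \int[mu]_(t in `]c, x[) (dpsi t * h t) = frac_int 1 h x - frac_int 1 h c.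
  move=> ih; rewrite !frac_int1.
  have iax : mu.-integrable `]a, x[ (EFin \o (fun t => dpsi t * h t)).
    by apply: (@integrableS _ _ _ mu `]a, b[) => //; apply: subset_itvl; rewrite bnd_simp.
  have := @Rintegral_itvB R (fun t => dpsi t * h t) (BRight a) (BLeft x) c iax.
  rewrite !bnd_simp (ltW ac) cx => /(_ isT isT) <-.
  rewrite (Rintegral_itv_bndo_bndc (a := BRight a) (r := c))//.
  by apply: integrableS iax => //; apply: subset_itvl; rewrite bnd_simp ltW.
have iS h : integrable_dpsi h -> mu.-integrable `]c, x[ (EFin \o (fun t => dpsi t * h t)).
  by move=> ih; exact: integrableS ih.
have kE : \int[mu]_(t in `]c, x[) k t =
    \int[mu]_(t in `]c, x[) (dpsi t * T t) - \int[mu]_(t in `]c, x[) (dpsi t * u t).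
  rewrite -RintegralB//; [|exact: iS|exact: iS].
  by apply: eq_Rintegral => t _; rewrite /k mulrBr.
have cab : a < c <= b by rewrite ac ltW// (lt_le_trans cx).
have k0 : 0 <= \int[mu]_(t in `]c, x[) k t.
  rewrite kE subr_ge0 [leLHS]split_int// !uv// -split_int//.
  apply: le_Rintegral => //; [exact: iS|exact: iS|].
  move=> t /sub; rewrite /= in_itv/= => /andP[at_ tb].
  by rewrite ler_wpM2l ?vT ?at_ ?ltW// (dpsi_gt0 ab psi_C1)// (ltW at_) ltW.
have : \int[mu]_(t in `]c, x[) k t <= \int[mu]_(t in `]c, x[) (k x / 2).
  apply: le_Rintegral => //.
  - have := @integrableB _ _ R mu _ (measurable_itv `]c, x[) _ _ (iS _ iT) (iS _ iu).
    by apply: eq_integrable => // t _; rewrite /= -EFinB /k mulrBr.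
  - apply/integrableP; split; first exact: measurable_cst.
    by rewrite integral_cst//= lebesgue_measure_itv/= lte_fin cx -EFinB -EFinM ltry.
  - move=> t; rewrite /= in_itv/= => /andP[ct tx]; apply/ltW/Hr.
      by rewrite /ball/= gtr0_norm ?subr_gt0//; lra.
    by rewrite in_itv/= (lt_trans ac ct) ltW// (lt_le_trans tx).
rewrite Rintegral_cst//= lebesgue_measure_itv/= lte_fin cx/=.
apply/negP; rewrite -ltNge; apply: lt_le_trans k0.
by rewrite nmulr_rlt0 ?subr_gt0//; lra.
Qed.

Lemma norm_le_of_frac_int1 u v T :
  integrable_dpsi u -> integrable_dpsi v -> integrable_dpsi T ->
  (forall t, a < t <= b -> u s @[s --> within `]a, b] (nbhs t)] --> u t) ->
  (forall t, a < t <= b -> T s @[s --> within `]a, b] (nbhs t)] --> T t) ->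
  (forall x, a < x <= b -> frac_int 1 u x = frac_int 1 v x) ->
  (forall t, a < t <= b -> `|v t| <= T t) ->
  forall x, a < x <= b -> `|u x| <= T x.
Proof.
move=> iu iv iT cu cT uv vT x xab.
have iN h : integrable_dpsi h -> integrable_dpsi (\- h).
  move=> /integrableN; apply: eq_integrable => // t _.
  by rewrite /= mulrN.
rewrite ler_norml; apply/andP; split; last first.
  apply: (le_of_frac_int1 iu iv iT) => // t tab.
  by apply: le_trans (vT t tab); rewrite ler_norm.
rewrite lerNl.
apply: (@le_of_frac_int1 (\- u) (\- v) T) => //; [exact: iN|exact: iN|..].
- by move=> t tab; apply: cvgN; exact: cu.
- move=> t /[dup] tab /andP[at_ tb].
  have frac_intN h : integrable_dpsi h -> frac_int 1 (\- h) t = - frac_int 1 h t.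
    move=> ih; rewrite !frac_int1.
    have iat : mu.-integrable `]a, t[ (EFin \o (fun t => dpsi t * h t)).
      by apply: (@integrableS _ _ _ mu `]a, b[) => //; apply: subset_itvl; rewrite bnd_simp.
    rewrite -[RHS]mulN1r -RintegralZl//; apply: eq_Rintegral => s _.
    by rewrite /= mulrN mulN1r.
  by rewrite !frac_intN// uv.
- by move=> t tab; apply: le_trans (vT t tab); rewrite /= -normrN ler_norm.
Qed.

End comparison.

Section mittag_leffler_series.
Set Implicit Arguments.
Unset Strict Implicit.
Context {R : realType}.
Implicit Types (alpha gamma z : R).

(** With L^alpha = 2 z, [Gamma_lower_bound] gives Gamma(alpha k + gamma) >= L^gamma (2 z)^k e^(-2 L)
    / 2, so the terms are at most C / 2^k. *)
Lemma is_cvg_mittag_leffler alpha gamma z : 0 < alpha -> 0 < gamma -> 0 < z ->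
  cvgn (series (fun k => z ^+ k / Gamma (alpha * k%:R + gamma))).
Proof.
move=> al0 g0 z0; pose L := (2 * z) `^ alpha^-1.
have z20 : 0 < 2 * z by rewrite mulr_gt0.
have L0 : 0 < L by rewrite powR_gt0.
have Lal : L `^ alpha = 2 * z.
  by rewrite -powRrM mulVf ?gt_eqF// powRr1// ltW.
pose C := 2 * expR (2 * L) / L `^ gamma.
have C0 : 0 < C by rewrite divr_gt0 ?mulr_gt0 ?expR_gt0 ?powR_gt0.
have s0 k : 0 < alpha * k%:R + gamma.
  by rewrite ltr_wpDl// mulr_ge0// ltW.
apply: (@series_le_cvg _ _ (geometric C 2^-1)).
- by move=> k; rewrite divr_ge0 ?exprn_ge0 ?ltW// Gamma_gt0.
- by move=> k; rewrite /geometric/= mulr_ge0 ?exprn_ge0 ?ltW.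
- move=> k; rewrite ler_pdivrMr ?Gamma_gt0//.
  have := Gamma_lower_bound (s0 k) L0.
  rewrite powRD ?(gt_eqF L0) ?implybT// powRrM Lal powR_mulrn ?(ltW z20)//.
  move=> H.
  have D0 : 0 <= geometric C 2^-1 k.
    by rewrite /geometric/= mulr_ge0 ?exprn_ge0 ?ltW.
  apply: le_trans (ler_wpM2l D0 H).
  rewrite /geometric/= /C expRN exprMn exprVn.
  rewrite le_eqVlt; apply/orP; left; apply/eqP; field.
  by rewrite !gt_eqF ?expR_gt0 ?powR_gt0 ?exprn_gt0.
- by apply: is_cvg_geometric_series; rewrite ger0_norm//; lra.
Qed.

End mittag_leffler_series.

(** * Fractional integrals of finite sums of the p_k *)

Section power_sums.
Set Implicit Arguments.
Unset Strict Implicit.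
Context {R : realType}.
Local Notation mu := (@lebesgue_measure R).
Variables (a b : R) (psi : R -> R).
Hypotheses (ab : a < b) (psi_C1 : C1_on a b psi)
  (psi_incr : {in `[a, b] &, {homo psi : s t / s < t}})
  (dpsi_neq0 : forall x, x \in `[a, b] -> deriv_within `[a, b] psi x != 0).
Local Notation dpsi := (dpsi a b psi).
Local Notation w t := (psi t - psi a).
Local Notation frac_int := (frac_int a b psi).
Local Notation frac_integrand := (frac_integrand a b psi).
Local Notation weighted_C := (weighted_C a b psi).
Implicit Types (p q r s t u x g c d : R) (h k y : R -> R) (e : nat -> R) (n : nat).

(* The regularity that the comparison of integrals requires; unlike membership in
   [weighted_C], it is visibly stable under linear combinations with mixed powers
   of w. *)
Definition tame h : Prop :=
  (forall p x, 0 < p -> a < x <= b ->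
     mu.-integrable `]a, x[ (EFin \o frac_integrand p h x)) /\
  (forall t, a < t <= b -> h u @[u --> within `]a, b] (nbhs t)] --> h t).

Lemma weighted_C_tame g h : 0 < g -> weighted_C g h -> tame h.
Proof.
move=> g0 wh; split=> [p x p0 axb|t tab].
  exact: (weighted_C_integrable ab psi_C1 psi_incr dpsi_neq0 g0 p0 wh axb).
exact: weighted_C_cvg wh tab.
Qed.

Lemma tame_w q : 0 < q -> tame (fun t => (w t) `^ (q - 1)).
Proof.
move=> q0; apply: (weighted_C_tame q0); exists (cst 1); split.
  by move=> t; exact: cvg_cst.
move=> t; rewrite in_itv/= => tab; have w0 := w_gt0 psi_incr tab.
by rewrite -powRD ?(gt_eqF w0) ?implybT// (_ : 1 - q + (q - 1) = 0) ?powRr0//; ring.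
Qed.

Lemma integrable_frac_integrand_lin p c d h k x :
  mu.-integrable `]a, x[ (EFin \o frac_integrand p h x) ->
  mu.-integrable `]a, x[ (EFin \o frac_integrand p k x) ->
  mu.-integrable `]a, x[ (EFin \o frac_integrand p (fun t => c * h t + d * k t) x).
Proof.
move=> ih ik.
have := @integrableD _ _ R mu _ (measurable_itv `]a, x[) _ _
  (@integrableZl _ _ R mu _ (measurable_itv `]a, x[) c _ ih)
  (@integrableZl _ _ R mu _ (measurable_itv `]a, x[) d _ ik).
apply: eq_integrable => // t _; rewrite /= -!EFinM -EFinD; congr EFin.
by rewrite /Defs.frac_integrand; ring.
Qed.

Lemma tame_lin c d h k : tame h -> tame k -> tame (fun t => c * h t + d * k t).
Proof.
move=> [ih ch] [ik ck]; split=> [p x p0 axb|t tab]; last first.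
  by apply: cvgD; apply: cvgMr; [exact: ch|exact: ck].
by apply: integrable_frac_integrand_lin; [exact: ih|exact: ik].
Qed.

Lemma frac_integrand1_integrable h x :
  mu.-integrable `]a, x[ (EFin \o frac_integrand 1 h x) ->
  mu.-integrable `]a, x[ (fun t => (dpsi t * h t)%:E).
Proof.
apply: eq_integrable => // t _.
by rewrite /= /Defs.frac_integrand subrr powRr0 mulr1.
Qed.

Lemma tame_integrable1 h : tame h -> mu.-integrable `]a, b[ (fun t => (dpsi t * h t)%:E).
Proof.
move=> [ih _]; apply: frac_integrand1_integrable; apply: ih => //.
by rewrite ab lexx.
Qed.

Variables (alpha gamma : R).
Hypotheses (alpha_gt0 : 0 < alpha) (gamma_gt0 : 0 < gamma).

Definition psi_power n t := (w t) `^ (alpha * n%:R + gamma - 1) / Gamma (alpha * n%:R + gamma).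

Let exponent_gt0 n : 0 < alpha * n%:R + gamma.
Proof. by rewrite ltr_wpDl// mulr_ge0// ltW. Qed.

Lemma tame_psi_power n : tame (psi_power n).
Proof.
have := tame_lin (Gamma (alpha * n%:R + gamma))^-1 0
  (tame_w (exponent_gt0 n)) (tame_w (exponent_gt0 n)).
congr tame; apply/funext => t; rewrite mul0r addr0 /psi_power; exact: mulrC.
Qed.

Lemma frac_int_psi_power n x : a < x <= b ->
  frac_int alpha (psi_power n) x = psi_power n.+1 x.
Proof.
move=> axb; have iw := (tame_w (exponent_gt0 n)).1 _ _ alpha_gt0 axb.
have -> : psi_power n = (fun t => (Gamma (alpha * n%:R + gamma))^-1 *
    (w t) `^ (alpha * n%:R + gamma - 1) + 0 * (w t) `^ (alpha * n%:R + gamma - 1)).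
  by apply/funext => t; rewrite mul0r addr0 mulrC.
rewrite frac_int_lin ?gt_eqF// mul0r addr0.
rewrite (frac_int_w ab psi_C1 psi_incr dpsi_neq0 alpha_gt0 (exponent_gt0 n) axb).
have -> : alpha + (alpha * n%:R + gamma) = alpha * n.+1%:R + gamma.
  by rewrite -natr1; ring.
rewrite /psi_power.
have := Gamma_neq0 (exponent_gt0 n); have := Gamma_neq0 (exponent_gt0 n.+1).
by move: (Gamma _) (Gamma _) => u v u0 v0; field; apply/andP.
Qed.

(** The coefficients are left arbitrary because each step of the iteration replaces them, by [next]
    in the final proof. *)
Definition psi_power_sum e n t := \sum_(k < n) e k * psi_power k t.

Lemma psi_power_sumS e n : psi_power_sum e n.+1 =
  (fun t => 1 * psi_power_sum e n t + e n * psi_power n t).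
Proof. by apply/funext => t; rewrite /psi_power_sum big_ord_recr/= mul1r. Qed.

Lemma tame_psi_power_sum e n : tame (psi_power_sum e n).
Proof.
elim: n => [|n IH]; last first.
  by rewrite psi_power_sumS; apply: tame_lin => //; exact: tame_psi_power.
have := tame_lin 0 0 (tame_psi_power 0) (tame_psi_power 0).
congr tame; apply/funext => t.
by rewrite /psi_power_sum big_ord0 !mul0r addr0.
Qed.

Lemma frac_int_psi_power_sum e n x : a < x <= b ->
  frac_int alpha (psi_power_sum e n) x = \sum_(k < n) e k * psi_power k.+1 x.
Proof.
move=> axb; elim: n => [|n IH].
  have -> : psi_power_sum e 0 = (fun t => 0 * psi_power 0 t + 0 * psi_power 0 t).
    by apply/funext => t; rewrite /psi_power_sum big_ord0 !mul0r addr0.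
  have ip := (tame_psi_power 0).1 _ _ alpha_gt0 axb.
  by rewrite frac_int_lin ?gt_eqF// big_ord0 !mul0r addr0.
have i1 := (tame_psi_power_sum e n).1 _ _ alpha_gt0 axb.
have i2 := (tame_psi_power n).1 _ _ alpha_gt0 axb.
by rewrite psi_power_sumS frac_int_lin ?gt_eqF// IH mul1r frac_int_psi_power// big_ord_recr.
Qed.

End power_sums.

(** * The iteration and its limit *)

Theorem theorem6 (R : realType) (a b : R) (psi : R -> R)
    (alpha beta gamma : R) (f : R -> R -> R) (A ya eps : R) (y ystar : R -> R)
    (a_gt0 : 0 < a) (ab : a < b)
    (alpha_gt0 : 0 < alpha) (alpha_lt1 : alpha < 1)
    (beta_ge0 : 0 <= beta) (beta_le1 : beta <= 1)
    (gammaE : gamma = alpha + beta * (1 - alpha))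
    (psi_C1 : C1_on a b psi)
    (psi_incr : {in `[a, b] &, {homo psi : s t / s < t}})
    (dpsi_neq0 : forall x, x \in `[a, b] -> deriv_within `[a, b] psi x != 0)
    (f_weighted : forall u : R -> R, weighted_C a b psi gamma u ->
       weighted_C a b psi gamma (fun x => f x (u x)))
    (A_gt0 : 0 < A)
    (f_lipschitz : forall x y1 y2 : R, x \in `]a, b] ->
       `|f x y1 - f x y2| <= A * `|y1 - y2|)
    (eps_gt0 : 0 < eps)
    (y_sol : hilfer_ivp a b psi alpha beta gamma f ya y)
    (ystar_sol : hilfer_ivp a b psi alpha beta gamma f (ya + eps) ystar) :
  forall x, x \in `]a, b] ->
    `|y x - ystar x| <=
      `|eps| * (psi x - psi a) `^ (gamma - 1) *
      mittag_leffler alpha gamma (A * (psi x - psi a) `^ alpha).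
Proof.
have gamma_gt0 : 0 < gamma.
  by rewrite gammaE ltr_wpDr// mulr_ge0// subr_ge0 ltW.
have wy : weighted_C a b psi gamma y by case: y_sol => -[].
have wys : weighted_C a b psi gamma ystar by case: ystar_sol => -[].
pose u t := y t - ystar t.
pose phi1 t := f t (y t); pose phi2 t := f t (ystar t).
have wphi1 : weighted_C a b psi gamma phi1 by exact: f_weighted.
have wphi2 : weighted_C a b psi gamma phi2 by exact: f_weighted.
pose tameP := weighted_C_tame ab psi_C1 psi_incr dpsi_neq0 gamma_gt0.
have t1 := tameP _ wphi1; have t2 := tameP _ wphi2.
have ty := tameP _ wy; have tys := tameP _ wys.
have V1 := hilfer_ivp_volterra ab psi_C1 psi_incr dpsi_neq0 alpha_gt0 alpha_lt1
  beta_ge0 beta_le1 gammaE wphi1 y_sol.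
have V2 := hilfer_ivp_volterra ab psi_C1 psi_incr dpsi_neq0 alpha_gt0 alpha_lt1
  beta_ge0 beta_le1 gammaE wphi2 ystar_sol.
pose w0 t := (psi t - psi a) `^ (gamma - 1).
have tw0 : tame a b psi w0 by exact: tame_w.
pose J phi := frac_int a b psi alpha phi.
have iJ phi x : tame a b psi phi -> a < x <= b ->
    lebesgue_measure.-integrable `]a, x[ (EFin \o frac_integrand a b psi 1 (J phi) x).
  move=> tphi axb; apply: integrable_frac_integrand_frac_int => //.
  - by rewrite lerDl ltW.
  - exact: tame_integrable1.
have uE : u = (fun t => 1 * y t + -1 * ystar t).
  by apply/funext => t; rewrite mul1r mulN1r.
have tu : tame a b psi u by rewrite uE; exact: tame_lin.
pose Jd t := 1 * J phi1 t + -1 * J phi2 t.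
have iJd x : a < x <= b ->
    lebesgue_measure.-integrable `]a, x[ (EFin \o frac_integrand a b psi 1 Jd x).
  by move=> axb; apply: integrable_frac_integrand_lin; exact: iJ.
(* Difference of the right-hand sides of the two Volterra equations; the sign is negative because
   [ystar] starts from ya + eps. *)
pose v t := - eps / Gamma gamma * w0 t + 1 * Jd t.
have uv x : a < x <= b -> frac_int a b psi 1 u x = frac_int a b psi 1 v x.
  move=> axb; have i1 h := fun th : tame a b psi h => th.1 1 x ltr01 axb.
  rewrite uE frac_int_lin ?oner_neq0//; [|exact: i1|exact: i1].
  rewrite V1// V2// frac_int_lin ?oner_neq0//; [|exact: i1|exact: iJd].
  rewrite frac_int_lin ?oner_neq0//; [|exact: iJ|exact: iJ].
  rewrite -/w0 -/(J _) -/(J _).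
  by move: (Defs.frac_int _ _ _ _ _ _) (Defs.frac_int _ _ _ _ _ _) (Defs.frac_int _ _ _ _ _ _) => I1 I2 I3; ring.
have iv : lebesgue_measure.-integrable `]a, b[ (fun t => (dpsi a b psi t * v t)%:E).
  have abb : a < b <= b by rewrite ab lexx.
  apply: frac_integrand1_integrable; apply: integrable_frac_integrand_lin.
    exact: tw0.1.
  exact: iJd.
pose S := psi_power_sum a psi alpha gamma.
(* Effect of one step on the coefficients: the Lipschitz bound multiplies by A, I^alpha raises the
   index by one, and the initial values contribute eps at index 0. *)
pose next e := (fun k => if k is k'.+1 then A * e k' else eps) : nat -> R.
have step e n : (forall k, 0 <= e k) -> (forall t, a < t <= b -> `|u t| <= S e n t) ->
    forall t, a < t <= b -> `|u t| <= S (next e) n.+1 t.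
  move=> e0 ue; have tS := tame_psi_power_sum ab psi_C1 psi_incr dpsi_neq0 alpha_gt0 gamma_gt0.
  apply: (norm_le_of_frac_int1 ab psi_C1 psi_incr dpsi_neq0 (v := v)) => //.
  - exact: tame_integrable1.
  - apply: tame_integrable1 => //; exact: tS.
  - exact: tu.2.
  - exact: (tS _ _).2.
  - move=> t tab; rewrite /v /S /psi_power_sum big_ord_recl/=.
    apply: (le_trans (ler_normD _ _)); apply: lerD.
      have c0 : 0 <= eps / Gamma gamma by rewrite divr_ge0// ltW// Gamma_gt0.
      rewrite /psi_power mulr0 add0r -/(w0 t) mulNr mulNr normrN normrM.
      by rewrite (ger0_norm c0) (ger0_norm (powR_ge0 _ _)) mulrAC -mulrA.
    have i1 := t1.1 _ _ alpha_gt0 tab; have i2 := t2.1 _ _ alpha_gt0 tab.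
    rewrite mul1r /Jd -frac_int_lin ?gt_eqF//.
    have -> : \sum_(i < n) A * e i * psi_power a psi alpha gamma i.+1 t =
        frac_int a b psi alpha (fun s => A * S e n s + 0 * S e n s) t.
      have iS := (tS e n).1 _ _ alpha_gt0 tab.
      rewrite frac_int_lin ?gt_eqF// mul0r addr0 frac_int_psi_power_sum//.
      by rewrite mulr_sumr; apply: eq_bigr => i _; rewrite mulrA.
    apply: (le_frac_int ab psi_C1 psi_incr dpsi_neq0) => //.
    + exact: (tame_lin 1 (-1) t1 t2).1.
    + exact: (tame_lin A 0 (tS e n) (tS e n)).1.
    + move=> s /andP[as_ st]; have sab : a < s <= b.
        by rewrite as_ ltW// (lt_le_trans st)//; case/andP: tab.
      rewrite mul1r mulN1r mul0r addr0 (le_trans (f_lipschitz _ _ _ _)) ?in_itv//.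
      by rewrite ler_wpM2l ?(ltW A_gt0)//; exact: ue.
have [M1 M10 yM1] := weighted_C_bound ab psi_incr wy.
have [M2 M20 yM2] := weighted_C_bound ab psi_incr wys.
(* The factor Gamma(gamma) undoes the division in p_0. *)
pose M := (M1 + M2) * Gamma gamma.
have G0 : 0 < Gamma gamma by exact: Gamma_gt0.
have M0 : 0 <= M by rewrite mulr_ge0 ?addr_ge0// ltW.
(* Coefficients after n steps. The sum reads the indices up to n; the constant value beyond them
   makes [E n.+1 = next (E n)] an equality of functions. *)
pose E n := (fun k => if (k < n)%N then eps * A ^+ k else M * A ^+ n) : nat -> R.
have uE_le n : forall t, a < t <= b -> `|u t| <= S (E n) n.+1 t.
  elim: n => [t tab|n IH].
    rewrite /S /psi_power_sum big_ord_recl big_ord0 addr0/= /E/= expr0 mulr1.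
    rewrite /psi_power mulr0 add0r mulrA mulrAC /M mulfK ?gt_eqF//.
    apply: le_trans (ler_normB _ _) _; rewrite mulrDl.
    by apply: lerD; [exact: yM1|exact: yM2].
  have -> : E n.+1 = next (E n).
    apply/funext => -[|k]; rewrite /E/= ?expr0 ?mulr1// ltnS.
    by case: ifP => _; rewrite exprS mulrCA.
  apply: step IH => k; rewrite /E; case: ifP => _; rewrite mulr_ge0 ?exprn_ge0// ltW//.
move=> x; rewrite in_itv/= => axb; rewrite (gtr0_norm eps_gt0).
have wx : 0 < psi x - psi a by exact: (w_gt0 psi_incr axb).
pose z := A * (psi x - psi a) `^ alpha.
have z0 : 0 < z by rewrite mulr_gt0// powR_gt0.
pose ml k := z ^+ k / Gamma (alpha * k%:R + gamma).
have mlE k : A ^+ k * psi_power a psi alpha gamma k x = w0 x * ml k.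
  rewrite /psi_power /ml /z exprMn -(powR_mulrn _ (powR_ge0 (psi x - psi a) alpha))// -powRrM /w0.
  by rewrite -addrA (powRD (r := alpha * k%:R)) ?(gt_eqF wx) ?implybT//; ring.
have cml : cvgn (series ml) by exact: is_cvg_mittag_leffler.
rewrite /mittag_leffler -/z -/(w0 x).
(* The terms of a convergent series tend to 0, which erases the trace of M. *)
have lim : (eps * w0 x * series ml n + M * w0 x * ml n) @[n --> \oo] -->
    eps * w0 x * limn (series ml) + M * w0 x * 0.
  by apply: cvgD; apply: cvgMr => //; exact: cvg_series_cvg_0.
rewrite mulr0 addr0 in lim.
apply: (cvgr_to_ge lim); near=> n.
apply: le_trans (uE_le n x axb) _; rewrite /S psi_power_sumS mul1r /psi_power_sum.
rewrite /E ltnn -!mulrA mlE lerD2r seriesEord/= !mulr_sumr.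
apply: ler_sum => k _.
by rewrite ltn_ord -!mulrA mlE.
Unshelve. all: end_near. Qed.
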